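(* Let $\mathcal{J}$ be a nontrivial complex $3$-dimensional derived Jordan algebra. Then $\mathcal{J}$ is isomorphic to one of the Jordan algebras $\mathrm{J}_{01},\dots,\mathrm{J}_{19}$, or to one of the derived commutative associative algebras $\mathrm{M}_{01},\mathrm{M}_{02},\mathrm{M}_{03},\mathrm{M}_{04}^{\alpha},\mathrm{M}_{05},\mathrm{M}_{06},\mathrm{M}_{07}$, $\mathrm{A}_{01}^{\alpha,\beta,\gamma},\dots,\mathrm{A}_{30}$ (all these lists are given in the context), or it is isomorphic to one of the following commutative algebras with basis $e_1,e_2,e_3$ (where $\alpha\in\mathbb{C}$): - $\mathcal{J}_{01}^{\alpha}$: $e_1e_1=e_1$, $e_1e_2=\frac12e_2$, $e_2e_3=e_1$, $e_3e_3=e_1+\alpha e_2$; - $\mathcal{J}_{02}$: $e_1e_1=e_1$, $e_1e_2=\frac12e_2$, $e_2e_3=e_1$, $e_3e_3=e_2$; - $\mathcal{J}_{03}$: $e_1e_1=e_1$, $e_1e_2=\frac12e_2$, $e_2e_3=e_1$; - $\mathcal{J}_{04}^{\alpha}$: $e_1e_1=e_1$, $e_1e_2=\frac12e_2$, $e_2e_3=e_2$, $e_3e_3=\alpha e_1$; - $\mathcal{J}_{05}$: $e_1e_1=e_1$, $e_1e_2=\frac12e_2$, $e_2e_3=e_2$, $e_3e_3=-4e_1+e_2$; - $\mathcal{J}_{06}$: $e_1e_1=e_1$, $e_1e_2=\frac12e_2$, $e_3e_3=e_1$; - $\mathcal{J}_{07}$: $e_1e_1=e_1$, $e_1e_2=\frac12e_2$,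 $e_3e_3=e_2$. All the algebras $\mathcal{J}_{01}^{\alpha},\dots,\mathcal{J}_{07}$ are pairwise non-isomorphic, except that $\mathcal{J}_{01}^{\alpha}\cong\mathcal{J}_{01}^{-\alpha}$.
   Context: An algebra is a vector space over $\mathbb{C}$ with a bilinear multiplication (not assumed associative). An algebra is nontrivial if its multiplication is nonzero. For an algebra $\mathrm{A}$, $\mathrm{A}^2$ denotes the subspace (subalgebra) spanned by all products $xy$, $x,y\in\mathrm{A}$. A commutative algebra is a Jordan algebra if it satisfies $(x^2y)x=x^2(yx)$. A commutative algebra $\mathrm{A}$ is a derived Jordan algebra if $\mathrm{A}^2$ is a Jordan algebra, and a derived commutative associative algebra if $\mathrm{A}^2$ is a commutative associative algebra. In all tables the algebras are commutative with basis $e_1,e_2,e_3$, parameters $\alpha,\beta,\gamma$ range over $\mathbb{C}$, and products of basis elements that are zero or follow from the listed ones by commutativity are omitted. Jordan algebras: $\mathrm{J}_{01}$: $e_1e_1=e_1$, $e_2e_2=e_2$; $\mathrm{J}_{02}$: $e_1e_1=e_1$, $e_1e_2=e_2$; $\mathrm{J}_{03}$: $e_1e_1=e_1$; $\mathrm{J}_{04}$: $e_1e_1=e_2$; $\mathrm{J}_{05}$: $e_1e_2=e_3$; $\mathrm{J}_{06}$: $e_1e_1=e_2$, $e_1e_2=e_3$; $\mathrm{J}_{07}$: $e_1e_1=e_1$, $e_2e_2=e_2$, $e_3e_3=e_3$; $\mathrm{J}_{08}$: $e_1e_1=e_1$, $e_2e_2=e_2$, $e_2e_3=e_3$; $\mathrm{J}_{09}$: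 $e_1e_1=e_1$, $e_1e_2=e_2$, $e_1e_3=e_3$; $\mathrm{J}_{10}$: $e_1e_1=e_1$, $e_1e_2=e_2$, $e_1e_3=e_3$, $e_2e_2=e_3$; $\mathrm{J}_{11}$: $e_1e_1=e_1$, $e_2e_2=e_3$; $\mathrm{J}_{12}$: $e_1e_1=e_1$, $e_2e_2=e_2$, $e_3e_3=e_1+e_2$, $e_1e_3=\frac12e_3$, $e_2e_3=\frac12e_3$; $\mathrm{J}_{13}$: $e_1e_1=e_1$, $e_1e_2=\frac12e_2$, $e_1e_3=e_3$; $\mathrm{J}_{14}$: $e_1e_1=e_1$, $e_1e_2=\frac12e_2$, $e_1e_3=\frac12e_3$; $\mathrm{J}_{15}$: $e_1e_1=e_1$, $e_2e_2=e_3$, $e_1e_2=\frac12e_2$; $\mathrm{J}_{16}$: $e_1e_1=e_1$, $e_2e_2=e_3$, $e_1e_2=\frac12e_2$, $e_1e_3=e_3$; $\mathrm{J}_{17}$: $e_1e_1=e_1$, $e_2e_2=e_2$, $e_1e_3=\frac12e_3$, $e_2e_3=\frac12e_3$; $\mathrm{J}_{18}$: $e_1e_1=e_1$, $e_1e_2=\frac12e_2$; $\mathrm{J}_{19}$: $e_1e_1=e_1$, $e_2e_2=e_2$, $e_1e_3=\frac12e_3$. Metabelian commutative algebras: $\mathrm{M}_{01}$: $e_1e_1=e_2$; $\mathrm{M}_{02}$: $e_1e_2=e_3$; $\mathrm{M}_{03}$: $e_1e_1=e_2$, $e_1e_2=e_3$; $\mathrm{M}_{04}^{\alpha}$: $e_1e_3=e_1$,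 $e_2e_3=\alpha e_2$; $\mathrm{M}_{05}$: $e_1e_3=e_1$, $e_3e_3=e_2$; $\mathrm{M}_{06}$: $e_1e_3=e_1+e_2$, $e_2e_3=e_2$; $\mathrm{M}_{07}$: $e_1e_3=e_1$, $e_2e_2=e_1$. Further derived commutative associative algebras: $\mathrm{A}_{01}^{\alpha,\beta,\gamma}$: $e_1e_1=e_1$, $e_2e_2=e_2$, $e_1e_3=\alpha e_2$, $e_2e_3=\beta e_1$, $e_3e_3=e_1+\gamma e_2$; $\mathrm{A}_{02}^{\alpha}$: $e_1e_1=e_1$, $e_2e_2=e_2$, $e_1e_3=e_2$, $e_2e_3=\alpha e_1$; $\mathrm{A}_{03}^{\alpha}$: $e_1e_1=e_1$, $e_2e_3=e_2$, $e_3e_3=\alpha e_1$; $\mathrm{A}_{04}^{\alpha}$: $e_1e_1=e_1$, $e_2e_3=e_1+e_2$, $e_3e_3=\alpha e_1$; $\mathrm{A}_{05}^{\alpha,\beta}$: $e_1e_1=e_1$, $e_1e_3=e_2$, $e_2e_3=\alpha e_1+e_2$, $e_3e_3=\beta e_1$; $\mathrm{A}_{06}^{\alpha}$: $e_1e_1=e_1$, $e_1e_3=e_2$, $e_2e_3=e_1$, $e_3e_3=\alpha e_2$; $\mathrm{A}_{07}$: $e_1e_1=e_1$, $e_1e_3=e_2$; $\mathrm{A}_{08}$: $e_1e_1=e_1$, $e_1e_3=e_2$, $e_3e_3=e_2$; $\mathrm{A}_{09}^{\alpha}$: $e_1e_1=e_1$, $e_1e_3=e_2$, $e_3e_3=e_1+\alpha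 e_2$; $\mathrm{A}_{10}$: $e_1e_1=e_1$, $e_2e_3=e_1$, $e_3e_3=e_2$; $\mathrm{A}_{11}$: $e_1e_1=e_1$, $e_3e_3=e_1+e_2$; $\mathrm{A}_{12}^{\alpha,\beta}$: $e_1e_1=e_1$, $e_1e_2=e_2$, $e_1e_3=e_1$, $e_2e_3=\alpha e_1$, $e_3e_3=\beta e_1+e_2$; $\mathrm{A}_{13}^{\alpha}$: $e_1e_1=e_1$, $e_1e_2=e_2$, $e_1e_3=e_1$, $e_2e_3=e_1$, $e_3e_3=\alpha e_1$; $\mathrm{A}_{14}^{\alpha}$: $e_1e_1=e_1$, $e_1e_2=e_2$, $e_1e_3=e_1$, $e_3e_3=\alpha e_1$; $\mathrm{A}_{15}^{\alpha}$: $e_1e_1=e_1$, $e_1e_2=e_2$, $e_2e_3=e_1$, $e_3e_3=e_1+\alpha e_2$; $\mathrm{A}_{16}$: $e_1e_1=e_1$, $e_1e_2=e_2$, $e_3e_3=e_1+e_2$; $\mathrm{A}_{17}$: $e_1e_1=e_1$, $e_1e_2=e_2$, $e_3e_3=e_1$; $\mathrm{A}_{18}$: $e_1e_1=e_1$, $e_1e_2=e_2$, $e_2e_3=e_1$, $e_3e_3=e_2$; $\mathrm{A}_{19}$: $e_1e_1=e_1$, $e_1e_2=e_2$, $e_2e_3=e_1$; $\mathrm{A}_{20}$: $e_1e_1=e_1$, $e_1e_2=e_2$, $e_3e_3=e_2$; $\mathrm{A}_{21}^{\alpha}$: $e_1e_1=e_2$, $e_2e_3=e_1+e_2$, $e_3e_3=\alpha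 e_2$; $\mathrm{A}_{22}$: $e_1e_1=e_2$, $e_2e_3=e_1$; $\mathrm{A}_{23}$: $e_1e_1=e_2$, $e_2e_3=e_1$, $e_3e_3=e_2$; $\mathrm{A}_{24}^{\alpha}$: $e_1e_1=e_2$, $e_1e_3=e_1$, $e_2e_3=\alpha e_2$; $\mathrm{A}_{25}$: $e_1e_1=e_2$, $e_1e_3=e_1$, $e_3e_3=e_2$; $\mathrm{A}_{26}$: $e_1e_1=e_2$, $e_1e_3=e_1+e_2$, $e_2e_3=e_2$; $\mathrm{A}_{27}$: $e_1e_1=e_2$, $e_3e_3=e_1$; $\mathrm{A}_{28}$: $e_1e_1=e_2$, $e_2e_3=e_2$, $e_3e_3=e_1$; $\mathrm{A}_{29}$: $e_1e_1=e_1$, $e_2e_3=e_1$; $\mathrm{A}_{30}$: $e_1e_1=e_1$, $e_3e_3=e_1$. *)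

(* Defs.v *)
From HB Require Import structures.
From mathcomp Require Import all_boot all_order all_algebra.
From mathcomp Require Import reals complex.

Set Implicit Arguments.
Unset Strict Implicit.
Unset Printing Implicit Defensive.

Import GRing.Theory.
Local Open Scope ring_scope.

(* An algebra is a vector space together with a bilinear product, here a term
   mu : {bilinear V -> V -> V}; the product of x and y is mu x y. *)
Section Algebras.
Context {F : fieldType}.

Definition alg_iso (V W : vectType F)
    (mu : {bilinear V -> V -> V}) (nu : {bilinear W -> W -> W}) : Prop :=
  exists f : {linear V -> W},
    bijective f /\ forall x y : V, f (mu x y) = nu (f x) (f y).

Context {V : vectType F}.
Implicit Types (mu : {bilinear V -> V -> V}) (S : V -> Prop).

Definition alg_nontrivial mu : Prop := exists x y : V, mu x y != 0.

(* Membership in the linear span of all products. *)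
Definition alg_square mu (v : V) : Prop :=
  exists (n : nat) (c : 'I_n -> F) (x y : 'I_n -> V),
    v = \sum_(i < n) c i *: mu (x i) (y i).

(* The next two predicates are meant for a subalgebra S: they say that S, with
   the product of the ambient algebra, is commutative, resp. Jordan. *)
Definition commutative_on S mu : Prop :=
  forall x y : V, S x -> S y -> mu x y = mu y x.

Definition jordan_on S mu : Prop :=
  commutative_on S mu /\
  forall x y : V, S x -> S y ->
    mu (mu (mu x x) y) x = mu (mu x x) (mu y x).

Definition derived_jordan mu : Prop :=
  commutative_on (fun=> True) mu /\ jordan_on (alg_square mu) mu.

End Algebras.

Section Tables.
Context {F : fieldType}.

Definition i1 : 'I_3 := @Ordinal 3 0 isT.
Definition i2 : 'I_3 := @Ordinal 3 1 isT.
Definition i3 : 'I_3 := @Ordinal 3 2 isT.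

Definition e1 : 'rV[F]_3 := delta_mx 0 i1.
Definition e2 : 'rV[F]_3 := delta_mx 0 i2.
Definition e3 : 'rV[F]_3 := delta_mx 0 i3.

(* An entry (i, j, v), used only with i <= j, records e_i e_j = e_j e_i = v;
   each pair (i, j) is listed at most once and products of basis vectors that
   are not listed are zero. *)
Definition mult_table := seq ('I_3 * 'I_3 * 'rV[F]_3).

Definition entry_coef (i j : 'I_3) (x y : 'rV[F]_3) : F :=
  if i == j then x 0 i * y 0 i else x 0 i * y 0 j + x 0 j * y 0 i.

Definition table_mul (t : mult_table) (x y : 'rV[F]_3) : 'rV[F]_3 :=
  \sum_(p <- t) entry_coef p.1.1 p.1.2 x y *: p.2.

Lemma table_mulC t x y : table_mul t x y = table_mul t y x.
Proof.
apply: eq_bigr => p _; congr (_ *: _); rewrite /entry_coef.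
by case: ifP => _; [rewrite mulrC | rewrite addrC; congr (_ + _); rewrite mulrC].
Qed.

Lemma table_mul_linearr t x a y z :
  table_mul t x (a *: y + z) = a *: table_mul t x y + table_mul t x z.
Proof.
rewrite /table_mul scaler_sumr -big_split; apply: eq_bigr => p _ /=.
rewrite scalerA -scalerDl; congr (_ *: _); rewrite /entry_coef.
case: ifP => _; rewrite !mxE !mulrDr ?[x 0 _ * (a * _)]mulrCA //.
by rewrite addrACA.
Qed.

Lemma table_mul_is_bilinear t :
  bilinear_for ( *:%R : F -> 'rV_3 -> 'rV_3) ( *:%R : F -> 'rV_3 -> 'rV_3)
    (table_mul t).
Proof.
split=> u a x y; last exact: table_mul_linearr.
by rewrite !(table_mulC t _ u) table_mul_linearr.
Qed.

HB.instance Definition _ t :=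
  bilinear_isBilinear.Build F 'rV[F]_3 'rV[F]_3 'rV[F]_3 *:%R *:%R
    (table_mul t) (table_mul_is_bilinear t).

Definition table_alg (t : mult_table) :
  {bilinear 'rV[F]_3 -> 'rV[F]_3 -> 'rV[F]_3} := table_mul t.

End Tables.

Arguments mult_table F : clear implicits.

Section Lists.
Context {F : fieldType}.
Local Notation half := (2%:R^-1 : F).

Inductive J_label : Set :=
  | J01 | J02 | J03 | J04 | J05 | J06 | J07 | J08 | J09 | J10
  | J11 | J12 | J13 | J14 | J15 | J16 | J17 | J18 | J19.

Definition J_table (l : J_label) : mult_table F :=
  match l with
  | J01 => [:: (i1, i1, e1); (i2, i2, e2)]
  | J02 => [:: (i1, i1, e1); (i1, i2, e2)]
  | J03 => [:: (i1, i1, e1)]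
  | J04 => [:: (i1, i1, e2)]
  | J05 => [:: (i1, i2, e3)]
  | J06 => [:: (i1, i1, e2); (i1, i2, e3)]
  | J07 => [:: (i1, i1, e1); (i2, i2, e2); (i3, i3, e3)]
  | J08 => [:: (i1, i1, e1); (i2, i2, e2); (i2, i3, e3)]
  | J09 => [:: (i1, i1, e1); (i1, i2, e2); (i1, i3, e3)]
  | J10 => [:: (i1, i1, e1); (i1, i2, e2); (i1, i3, e3); (i2, i2, e3)]
  | J11 => [:: (i1, i1, e1); (i2, i2, e3)]
  | J12 => [:: (i1, i1, e1); (i2, i2, e2); (i3, i3, e1 + e2);
               (i1, i3, half *: e3); (i2, i3, half *: e3)]
  | J13 => [:: (i1, i1, e1); (i1, i2, half *: e2); (i1, i3, e3)]
  | J14 => [:: (i1, i1, e1); (i1, i2, half *: e2); (i1, i3, half *: e3)]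
  | J15 => [:: (i1, i1, e1); (i2, i2, e3); (i1, i2, half *: e2)]
  | J16 => [:: (i1, i1, e1); (i2, i2, e3); (i1, i2, half *: e2); (i1, i3, e3)]
  | J17 => [:: (i1, i1, e1); (i2, i2, e2);
               (i1, i3, half *: e3); (i2, i3, half *: e3)]
  | J18 => [:: (i1, i1, e1); (i1, i2, half *: e2)]
  | J19 => [:: (i1, i1, e1); (i2, i2, e2); (i1, i3, half *: e3)]
  end.

Inductive M_label : Type :=
  | M01 | M02 | M03 | M04 of F | M05 | M06 | M07.

Definition M_table (l : M_label) : mult_table F :=
  match l with
  | M01 => [:: (i1, i1, e2)]
  | M02 => [:: (i1, i2, e3)]
  | M03 => [:: (i1, i1, e2); (i1, i2, e3)]
  | M04 a => [:: (i1, i3, e1); (i2, i3, a *: e2)]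
  | M05 => [:: (i1, i3, e1); (i3, i3, e2)]
  | M06 => [:: (i1, i3, e1 + e2); (i2, i3, e2)]
  | M07 => [:: (i1, i3, e1); (i2, i2, e1)]
  end.

Inductive A_label : Type :=
  | A01 of F & F & F | A02 of F | A03 of F | A04 of F | A05 of F & F
  | A06 of F | A07 | A08 | A09 of F | A10 | A11 | A12 of F & F | A13 of F
  | A14 of F | A15 of F | A16 | A17 | A18 | A19 | A20 | A21 of F | A22 | A23
  | A24 of F | A25 | A26 | A27 | A28 | A29 | A30.

Definition A_table (l : A_label) : mult_table F :=
  match l with
  | A01 a b c => [:: (i1, i1, e1); (i2, i2, e2); (i1, i3, a *: e2);
                     (i2, i3, b *: e1); (i3, i3, e1 + c *: e2)]
  | A02 a => [:: (i1, i1, e1); (i2, i2, e2); (i1, i3, e2); (i2, i3, a *: e1)]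
  | A03 a => [:: (i1, i1, e1); (i2, i3, e2); (i3, i3, a *: e1)]
  | A04 a => [:: (i1, i1, e1); (i2, i3, e1 + e2); (i3, i3, a *: e1)]
  | A05 a b => [:: (i1, i1, e1); (i1, i3, e2); (i2, i3, a *: e1 + e2);
                   (i3, i3, b *: e1)]
  | A06 a => [:: (i1, i1, e1); (i1, i3, e2); (i2, i3, e1); (i3, i3, a *: e2)]
  | A07 => [:: (i1, i1, e1); (i1, i3, e2)]
  | A08 => [:: (i1, i1, e1); (i1, i3, e2); (i3, i3, e2)]
  | A09 a => [:: (i1, i1, e1); (i1, i3, e2); (i3, i3, e1 + a *: e2)]
  | A10 => [:: (i1, i1, e1); (i2, i3, e1); (i3, i3, e2)]
  | A11 => [:: (i1, i1, e1); (i3, i3, e1 + e2)]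
  | A12 a b => [:: (i1, i1, e1); (i1, i2, e2); (i1, i3, e1);
                   (i2, i3, a *: e1); (i3, i3, b *: e1 + e2)]
  | A13 a => [:: (i1, i1, e1); (i1, i2, e2); (i1, i3, e1); (i2, i3, e1);
                 (i3, i3, a *: e1)]
  | A14 a => [:: (i1, i1, e1); (i1, i2, e2); (i1, i3, e1); (i3, i3, a *: e1)]
  | A15 a => [:: (i1, i1, e1); (i1, i2, e2); (i2, i3, e1);
                 (i3, i3, e1 + a *: e2)]
  | A16 => [:: (i1, i1, e1); (i1, i2, e2); (i3, i3, e1 + e2)]
  | A17 => [:: (i1, i1, e1); (i1, i2, e2); (i3, i3, e1)]
  | A18 => [:: (i1, i1, e1); (i1, i2, e2); (i2, i3, e1); (i3, i3, e2)]
  | A19 => [:: (i1, i1, e1); (i1, i2, e2); (i2, i3, e1)]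
  | A20 => [:: (i1, i1, e1); (i1, i2, e2); (i3, i3, e2)]
  | A21 a => [:: (i1, i1, e2); (i2, i3, e1 + e2); (i3, i3, a *: e2)]
  | A22 => [:: (i1, i1, e2); (i2, i3, e1)]
  | A23 => [:: (i1, i1, e2); (i2, i3, e1); (i3, i3, e2)]
  | A24 a => [:: (i1, i1, e2); (i1, i3, e1); (i2, i3, a *: e2)]
  | A25 => [:: (i1, i1, e2); (i1, i3, e1); (i3, i3, e2)]
  | A26 => [:: (i1, i1, e2); (i1, i3, e1 + e2); (i2, i3, e2)]
  | A27 => [:: (i1, i1, e2); (i3, i3, e1)]
  | A28 => [:: (i1, i1, e2); (i2, i3, e2); (i3, i3, e1)]
  | A29 => [:: (i1, i1, e1); (i2, i3, e1)]
  | A30 => [:: (i1, i1, e1); (i3, i3, e1)]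
  end.

(* DJ is the calligraphic J family, to be distinguished from J_label. *)
Inductive DJ_label : Type :=
  | DJ01 of F | DJ02 | DJ03 | DJ04 of F | DJ05 | DJ06 | DJ07.

Definition DJ_table (l : DJ_label) : mult_table F :=
  match l with
  | DJ01 a => [:: (i1, i1, e1); (i1, i2, half *: e2); (i2, i3, e1);
                  (i3, i3, e1 + a *: e2)]
  | DJ02 => [:: (i1, i1, e1); (i1, i2, half *: e2); (i2, i3, e1); (i3, i3, e2)]
  | DJ03 => [:: (i1, i1, e1); (i1, i2, half *: e2); (i2, i3, e1)]
  | DJ04 a => [:: (i1, i1, e1); (i1, i2, half *: e2); (i2, i3, e2);
                  (i3, i3, a *: e1)]
  | DJ05 => [:: (i1, i1, e1); (i1, i2, half *: e2); (i2, i3, e2);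
                (i3, i3, - 4%:R *: e1 + e2)]
  | DJ06 => [:: (i1, i1, e1); (i1, i2, half *: e2); (i3, i3, e1)]
  | DJ07 => [:: (i1, i1, e1); (i1, i2, half *: e2); (i3, i3, e2)]
  end.

End Lists.

Arguments M_label F : clear implicits.
Arguments A_label F : clear implicits.
Arguments DJ_label F : clear implicits.

(* Main.v *)
(** Everything is done in coordinates: an algebra with a basis is given by six
    structure vectors, and membership in the list is shown by exhibiting the
    three vectors of a new basis.  The cases are split by the size of the square.

    If the square lies in a line, the product is a symmetric bilinear form
    times a fixed vector.  If it lies in a plane [B], only
    [(x ^ 2) ^ 2 = (x ^ 2 x) x] is used on [B]: either some [x] in [B] has
    [x] and [x ^ 2] independent, and then [B] is spanned by the powers of [x]
    and determined by the two roots of [x ^ 3 = (r + s) x ^ 2 - r s x], or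
    [x ^ 2 = f(x) x] for a linear form [f]; the remaining products [e_i e_3]
    are normalised by changing [e_3] and by automorphisms of [B].  If the
    square is everything, the algebra is Jordan.  It then contains an
    idempotent unless every [x] satisfies [x ^ 3 = 0], which forces the square
    into a plane; with an idempotent, the Peirce decomposition leaves nine
    small cases.  The unital ones are again either generated by one element
    (three roots) or given by a quadratic form.

    For the non-isomorphism, every algebra of the last family has the shape
    [e1 e1 = e1], [e1 e2 = e2 / 2], [e2 e3 = c e1 + d e2],
    [e3 e3 = p e1 + q e2], and the possible changes of basis between two
    algebras of this shape can be computed explicitly. *)

Require Import Defs.
From HB Require Import structures.
From mathcomp Require Import all_boot all_order all_algebra.
From mathcomp Require Import reals complex boolp ring.

Set Implicit Arguments.
Unset Strict Implicit.
Unset Printing Implicit Defensive.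

Import Order.TTheory GRing.Theory Num.Theory.
Local Open Scope ring_scope.

(** * Coordinates and changes of basis *)

Section VectorCoord.
Context {F : fieldType} {V : vectType F}.

(** Vector identities in [V] are proved coordinatewise in a fixed basis, where they become scalar
    identities for [ring] and [field]. *)
Definition vphi (k : 'I_(\dim {:V})) (v : V) : F := coord (vbasis {:V}) k v.

Lemma vphiP (v w : V) : (forall k, vphi k v = vphi k w) <-> v = w.
Proof.
split=> [E|->//]; rewrite (coord_vbasis (memvf v)) (coord_vbasis (memvf w)).
by apply: eq_bigr => k _; congr (_ *: _); apply: E.
Qed.

Lemma vphiD k v w : vphi k (v + w) = vphi k v + vphi k w.
Proof. exact: raddfD. Qed.

Lemma vphiN k v : vphi k (- v) = - vphi k v.
Proof. exact: raddfN. Qed.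

Lemma vphiZ k a v : vphi k (a *: v) = a * vphi k v.
Proof. exact: linearZ. Qed.

Lemma vphi0 k : vphi k 0 = 0.
Proof. exact: raddf0. Qed.

End VectorCoord.

Definition vphiE := (@vphiD, @vphiN, @vphiZ, @vphi0).

Ltac to_scalar k := apply/vphiP => k; rewrite !vphiE.
Ltac vring := let k := fresh "k" in to_scalar k; ring.
Ltac vfield := let k := fresh "k" in to_scalar k; field.

Section Coordinates.
Context {F : fieldType}.

Definition vec := (F * F * F)%type.
Definition co1 (p : vec) := p.1.1.
Definition co2 (p : vec) := p.1.2.
Definition co3 (p : vec) := p.2.

(* The products [e_i e_j], [i <= j], of a commutative algebra with basis
   [e_1, e_2, e_3], in coordinates. *)
Record structure := Structure {
  c11 : vec; c12 : vec; c13 : vec; c22 : vec; c23 : vec; c33 : vec }.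

Definition comb6 (k : vec -> F) (s : structure) (p q : vec) : F :=
  let: (x1, x2, x3) := p in let: (y1, y2, y3) := q in
  x1 * y1 * k (c11 s) + (x1 * y2 + x2 * y1) * k (c12 s)
  + (x1 * y3 + x3 * y1) * k (c13 s) + x2 * y2 * k (c22 s)
  + (x2 * y3 + x3 * y2) * k (c23 s) + x3 * y3 * k (c33 s).

Definition smul (s : structure) (p q : vec) : vec :=
  (comb6 co1 s p q, comb6 co2 s p q, comb6 co3 s p q).

(** Converts coordinates [p] relative to [p1, p2, p3] into ambient coordinates. *)
Definition comb3 (p1 p2 p3 p : vec) : vec :=
  let: (x, y, z) := p in
  (x * co1 p1 + y * co1 p2 + z * co1 p3,
   x * co2 p1 + y * co2 p2 + z * co2 p3,
   x * co3 p1 + y * co3 p2 + z * co3 p3).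

Definition det3 (p1 p2 p3 : vec) : F :=
  co1 p1 * (co2 p2 * co3 p3 - co3 p2 * co2 p3)
  - co2 p1 * (co1 p2 * co3 p3 - co3 p2 * co1 p3)
  + co3 p1 * (co1 p2 * co2 p3 - co2 p2 * co1 p3).

(** Cramer's rule. *)
Lemma comb3_onto p1 p2 p3 p : det3 p1 p2 p3 != 0 ->
  exists q, comb3 p1 p2 p3 q = p.
Proof.
move: p1 p2 p3 p => [[a b] c] [[d e] f] [[g h] i] [[x y] z].
rewrite /det3 /co1 /co2 /co3 /= => D.
pose w := (a * (e * i - f * h) - b * (d * i - f * g) + c * (d * h - e * g)).
exists ((x * (e * i - f * h) - y * (d * i - f * g) + z * (d * h - e * g)) / w,
        (a * (y * i - z * h) - b * (x * i - z * g) + c * (x * h - y * g)) / w,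
        (a * (e * z - f * y) - b * (d * z - f * x) + c * (d * y - e * x)) / w).
by rewrite /comb3 /co1 /co2 /co3 /w /=; congr (_, _, _); field.
Qed.

(** Each coordinate times the determinant is a combination, with cofactors as coefficients, of the
    three entries that vanish. *)
Lemma comb3_inj p1 p2 p3 p : det3 p1 p2 p3 != 0 ->
  comb3 p1 p2 p3 p = (0, 0, 0) -> p = (0, 0, 0).
Proof.
move: p1 p2 p3 p => [[a b] c] [[d e] f] [[g h] i] [[x y] z].
rewrite /det3 /comb3 /co1 /co2 /co3 /= => D [E1 E2 E3].
set w := (X in X != 0) in D.
have k (t : F) : w * t = 0 -> t = 0.
  by move/eqP; rewrite mulf_eq0 (negPf D) => /eqP.
congr (_, _, _); apply: k; rewrite /w.
- transitivity ((e * i - f * h) * (x * a + y * d + z * g)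
    - (d * i - f * g) * (x * b + y * e + z * h)
    + (d * h - e * g) * (x * c + y * f + z * i)); first by ring.
  by rewrite E1 E2 E3; ring.
- transitivity (- (b * i - c * h) * (x * a + y * d + z * g)
    + (a * i - c * g) * (x * b + y * e + z * h)
    - (a * h - b * g) * (x * c + y * f + z * i)); first by ring.
  by rewrite E1 E2 E3; ring.
- transitivity ((b * f - c * e) * (x * a + y * d + z * g)
    - (a * f - c * d) * (x * b + y * e + z * h)
    + (a * e - b * d) * (x * c + y * f + z * i)); first by ring.
  by rewrite E1 E2 E3; ring.
Qed.

(* [p1, p2, p3] are the vectors of the new basis in old coordinates, [s] is the
   old structure and [s'] the new one. *)
Definition change_of_structure (s : structure) (p1 p2 p3 : vec)
    (s' : structure) : Prop :=
  [/\ smul s p1 p1 = comb3 p1 p2 p3 (c11 s'),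
      smul s p1 p2 = comb3 p1 p2 p3 (c12 s')
    & smul s p1 p3 = comb3 p1 p2 p3 (c13 s')] /\
  [/\ smul s p2 p2 = comb3 p1 p2 p3 (c22 s'),
      smul s p2 p3 = comb3 p1 p2 p3 (c23 s')
    & smul s p3 p3 = comb3 p1 p2 p3 (c33 s')].

Context {V : vectType F}.
Implicit Types (mu : {bilinear V -> V -> V}) (b : V * V * V).

Definition lin b (p : vec) : V :=
  co1 p *: b.1.1 + co2 p *: b.1.2 + co3 p *: b.2.

Definition indep b := forall p, lin b p = 0 -> p = (0, 0, 0).
Definition basis3 b := indep b /\ forall v, exists p, v = lin b p.

Definition has_structure mu b (s : structure) : Prop :=
  let: (v1, v2, v3) := b in
  [/\ mu v1 v1 = lin b (c11 s), mu v1 v2 = lin b (c12 s)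
    & mu v1 v3 = lin b (c13 s)] /\
  [/\ mu v2 v2 = lin b (c22 s), mu v2 v3 = lin b (c23 s)
    & mu v3 v3 = lin b (c33 s)].

Definition commutative_alg mu := forall x y : V, mu x y = mu y x.

Lemma lin_sub b p q :
  lin b p - lin b q = lin b (co1 p - co1 q, co2 p - co2 q, co3 p - co3 q).
Proof.
by case: p => [[x y] z]; rewrite /lin /co1 /co2 /co3 /=; vring.
Qed.

Lemma lin_inj b p q : indep b -> lin b p = lin b q -> p = q.
Proof.
move=> B E; have := lin_sub b p q; rewrite E subrr => /esym /B.
case: p q {E} => [[x y] z] [[x' y'] z'] /= [].
rewrite /co1 /co2 /co3 /=.
by move=> /eqP; rewrite subr_eq0 => /eqP-> /eqP;
  rewrite subr_eq0 => /eqP-> /eqP; rewrite subr_eq0 => /eqP->.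
Qed.

Lemma lin_comb b p1 p2 p3 p :
  lin (lin b p1, lin b p2, lin b p3) p = lin b (comb3 p1 p2 p3 p).
Proof.
case: p => [[x y] z]; rewrite /lin /comb3 /co1 /co2 /co3 /=; vring.
Qed.

Lemma mul_lin mu b s p q : commutative_alg mu -> has_structure mu b s ->
  mu (lin b p) (lin b q) = lin b (smul s p q).
Proof.
case: b => [[v1 v2] v3] C [[E11 E12 E13] [E22 E23 E33]].
case: p q => [[x1 x2] x3] [[y1 y2] y3]; rewrite {1 2}/lin /co1 /co2 /co3 /=.
rewrite !(linearDl, linearDr, linearZl_LR, linearZr_LR) /=.
rewrite (C v2 v1) (C v3 v1) (C v3 v2) E11 E12 E13 E22 E23 E33.
by rewrite /lin /smul /comb6 /co1 /co2 /co3 /=; vring.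
Qed.

Lemma basis3_comb b p1 p2 p3 : basis3 b -> det3 p1 p2 p3 != 0 ->
  basis3 (lin b p1, lin b p2, lin b p3).
Proof.
move=> [I S] D; split=> [p | v]; first by rewrite lin_comb => /I /comb3_inj; apply.
have [q ->] := S v; have [r <-] := comb3_onto q D.
by exists r; rewrite lin_comb.
Qed.

(** The determinant is a separate [d], so that its nonvanishing can be checked on a factored
    expression. *)
Lemma rebase mu b s (p1 p2 p3 : vec) (d : F) s' :
  commutative_alg mu -> basis3 b -> has_structure mu b s ->
  d != 0 -> det3 p1 p2 p3 = d -> change_of_structure s p1 p2 p3 s' ->
  exists2 b', basis3 b' & has_structure mu b' s'.
Proof.
move=> C B S d0 D [[E11 E12 E13] [E22 E23 E33]].
exists (lin b p1, lin b p2, lin b p3); first by apply: basis3_comb; rewrite ?D.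
by do 2!split; rewrite lin_comb (mul_lin _ _ C S) ?E11 ?E12 ?E13 ?E22 ?E23 ?E33.
Qed.

End Coordinates.
Arguments vec F : clear implicits.
Arguments structure F : clear implicits.

(** * Table algebras in coordinates *)

Section Tables.
Context {F : fieldType}.

Definition row3 (p : vec F) : 'rV[F]_3 := lin (e1, e2, e3) p.
Definition vec_of_row (r : 'rV[F]_3) : vec F := (r 0 i1, r 0 i2, r 0 i3).

Lemma row3K (r : 'rV[F]_3) : row3 (vec_of_row r) = r.
Proof.
apply/rowP => -[[|[|[|//]]] lt]; rewrite /row3 /lin /= !mxE /= /co1 /co2 /co3 /=;
by rewrite ?(mulr0, mulr1, addr0, add0r); congr (r _ _); apply: val_inj.
Qed.

Lemma vec_of_rowK p : vec_of_row (row3 p) = p.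
Proof.
case: p => [[x y] z]; rewrite /vec_of_row /row3 /lin /= !mxE /= /co1 /co2 /co3 /=.
by rewrite ?(mulr0, mulr1, addr0, add0r).
Qed.

Lemma basis3_std : basis3 (e1, e2, e3 : 'rV[F]_3).
Proof.
split=> [p E|v]; last by exists (vec_of_row v); exact/esym/row3K.
have := vec_of_rowK p; rewrite /row3 E => <-.
by rewrite /vec_of_row !mxE.
Qed.

Definition structure_of (t : mult_table F) : structure F :=
  let c x y := vec_of_row (table_mul t x y) in
  Structure (c e1 e1) (c e1 e2) (c e1 e3) (c e2 e2) (c e2 e3) (c e3 e3).

Arguments structure_of : simpl never.

Lemma table_has_structure t :
  has_structure (table_alg t) (e1, e2, e3) (structure_of t).
Proof. by do 2!split; rewrite -/(row3 _) row3K. Qed.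

Lemma table_comm t : @commutative_alg F _ (table_alg t).
Proof. exact: table_mulC. Qed.

(** Sending a row to the combination of [b] with its entries is a linear bijection because [b] is a
    basis, and it is multiplicative because the structures agree; the isomorphism is its inverse. *)
Lemma structure_alg_iso (V : vectType F) (mu : {bilinear V -> V -> V}) b t :
  commutative_alg mu -> basis3 b -> has_structure mu b (structure_of t) ->
  alg_iso mu (table_alg t).
Proof.
move=> C B S.
pose g (r : 'rV[F]_3) : V := lin b (vec_of_row r).
have gL a : {morph g : u v / a *: u + v >-> a *: u + v}.
  by move=> u v; rewrite /g /vec_of_row /lin /co1 /co2 /co3 !mxE /=; vring.
have gP v : exists r, g r = v.
  have [p ->] := B.2 v.
  by exists (row3 p); rewrite /g vec_of_rowK.
(* The inverse is chosen from the surjectivity of [g]; its linearity then follows from the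
   injectivity of [g]. *)
pose f v : 'rV[F]_3 := projT1 (cid (gP v)).
have gf : cancel f g by move=> v; rewrite /f; case: cid.
have gI : injective g.
  by move=> r r' /(lin_inj B.1) E; rewrite -(row3K r) E row3K.
have fg : cancel g f by move=> r; apply: gI; rewrite gf.
have fL : linear f by move=> a u v; apply: gI; rewrite gL !gf.
pose fM := GRing.isLinear.Build F V 'rV[F]_3 *:%R f fL.
pose fl : {linear V -> 'rV[F]_3} := HB.pack f fM.
exists fl; split; first by exists g.
move=> x y; apply: gI; rewrite gf.
have -> : mu x y = mu (g (f x)) (g (f y)) by rewrite !gf.
rewrite {1 2}/g (mul_lin _ _ C S).
transitivity (g (table_alg t (row3 (vec_of_row (f x))) (row3 (vec_of_row (f y)))));
  last by rewrite !row3K.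
by rewrite (mul_lin _ _ (@table_comm t) (table_has_structure t)) /g vec_of_rowK.
Qed.

End Tables.

(** * Computing the structure vectors of a table *)

Section TableStructure.
Context {F : fieldType}.

Definition vadd (p q : vec F) : vec F :=
  (co1 p + co1 q, co2 p + co2 q, co3 p + co3 q).
Definition vscale a (p : vec F) : vec F := (a * co1 p, a * co2 p, a * co3 p).

(** A symbolic counterpart of one table row, so that the structure vectors of a concrete table
    reduce by computation. It ignores an entry with [i > j], hence the order condition in the lemmas
    below. *)
Definition add_entry (e : 'I_3 * 'I_3 * 'rV[F]_3) (s : structure F) :=
  let v := vec_of_row e.2 in
  let: Structure s11 s12 s13 s22 s23 s33 := s in
  match val e.1.1, val e.1.2 with
  | 0, 0 => Structure (vadd v s11) s12 s13 s22 s23 s33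
  | 0, 1 => Structure s11 (vadd v s12) s13 s22 s23 s33
  | 0, 2 => Structure s11 s12 (vadd v s13) s22 s23 s33
  | 1, 1 => Structure s11 s12 s13 (vadd v s22) s23 s33
  | 1, 2 => Structure s11 s12 s13 s22 (vadd v s23) s33
  | 2, 2 => Structure s11 s12 s13 s22 s23 (vadd v s33)
  | _, _ => s
  end%N.

Definition structure0 : structure F :=
  let z := (0, 0, 0) in Structure z z z z z z.

Lemma vec_of_rowD r r' : vec_of_row (r + r') = vadd (vec_of_row r) (vec_of_row r').
Proof. by rewrite /vec_of_row !mxE. Qed.
Lemma vec_of_rowZ a r : vec_of_row (a *: r) = vscale a (vec_of_row r).
Proof. by rewrite /vec_of_row !mxE. Qed.
Lemma vec_of_e1 : vec_of_row e1 = (1, 0, 0) :> vec F.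
Proof. by rewrite /vec_of_row !mxE. Qed.
Lemma vec_of_e2 : vec_of_row e2 = (0, 1, 0) :> vec F.
Proof. by rewrite /vec_of_row !mxE. Qed.
Lemma vec_of_e3 : vec_of_row e3 = (0, 0, 1) :> vec F.
Proof. by rewrite /vec_of_row !mxE. Qed.
Lemma vec_of_0 : vec_of_row 0 = (0, 0, 0) :> vec F.
Proof. by rewrite /vec_of_row !mxE. Qed.

Lemma vadd0 p : vadd (0, 0, 0) p = p.
Proof. by case: p => [[x y] z]; rewrite /vadd /co1 /co2 /co3 /= !add0r. Qed.
Lemma vaddr0 p : vadd p (0, 0, 0) = p.
Proof. by case: p => [[x y] z]; rewrite /vadd /co1 /co2 /co3 /= !addr0. Qed.

Lemma structure_of_cons (e : 'I_3 * 'I_3 * 'rV[F]_3) (t : mult_table F) :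
  (val e.1.1 <= val e.1.2)%N ->
  structure_of (e :: t) = add_entry e (structure_of t).
Proof.
have D x y : table_mul (e :: t) x y =
    entry_coef e.1.1 e.1.2 x y *: e.2 + table_mul t x y.
  by rewrite /table_mul big_cons.
rewrite /structure_of !D // !vec_of_rowD !vec_of_rowZ.
have Z p : vscale 0 p = (0, 0, 0) by rewrite /vscale !mul0r.
have O p : vscale 1 p = p by case: p => [[x y] z]; rewrite /vscale !mul1r.
case: e {D} => [[i j] v] /=; rewrite /add_entry /=.
case: i => -[|[|[|i]]] li; case: j => -[|[|[|j]]] lj //= _;
  rewrite /entry_coef /= !mxE /= ?(mulr0, mulr1, addr0, add0r) !(Z, O) ?vadd0 //.
Qed.

Lemma structure_of_nil : structure_of [::] = structure0.
Proof. by rewrite /structure_of /table_mul !big_nil !vec_of_0. Qed.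

Lemma structure_ofE (t : mult_table F) :
  all (fun e => val e.1.1 <= val e.1.2)%N t ->
  structure_of t = foldr add_entry structure0 t.
Proof.
elim: t => [_|e t IH /= /andP[le_e le_t]]; first exact: structure_of_nil.
by rewrite structure_of_cons // IH.
Qed.

End TableStructure.

Definition vecE := (@vec_of_rowD, @vec_of_rowZ, @vec_of_e1, @vec_of_e2, @vec_of_e3, @vaddr0).

Ltac table_simpl :=
  rewrite ?structure_ofE //= /add_entry /= ?vecE /vscale /vadd /co1 /co2 /co3 /=.

Definition in_list {F : fieldType} {V : vectType F} (mu : {bilinear V -> V -> V}) : Prop :=
  [\/ exists l : J_label, alg_iso mu (table_alg (J_table l)),
      exists l : M_label F, alg_iso mu (table_alg (M_table l)),
      exists l : A_label F, alg_iso mu (table_alg (A_table l)) |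
      exists l : DJ_label F, alg_iso mu (table_alg (DJ_table l))].

(** * Membership in the list from an explicit change of basis *)

Section Listing.
Context {F : fieldType} {V : vectType F} (mu : {bilinear V -> V -> V}).
Context (b : V * V * V) (s : structure F).
Hypotheses (C : commutative_alg mu) (B : basis3 b) (S : has_structure mu b s).

Lemma table_alg_iso t p1 p2 p3 d : d != 0 -> det3 p1 p2 p3 = d ->
  change_of_structure s p1 p2 p3 (structure_of t) -> alg_iso mu (table_alg t).
Proof.
by move=> D Ed E; have [b' B' S'] := rebase C B S D Ed E; exact: structure_alg_iso S'.
Qed.

Lemma in_list_J l p1 p2 p3 d : d != 0 -> det3 p1 p2 p3 = d ->
  change_of_structure s p1 p2 p3 (structure_of (J_table l)) -> in_list mu.
Proof. by move=> D Ed E; apply: Or41; exists l; apply: (table_alg_iso D Ed). Qed.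

Lemma in_list_M l p1 p2 p3 d : d != 0 -> det3 p1 p2 p3 = d ->
  change_of_structure s p1 p2 p3 (structure_of (M_table l)) -> in_list mu.
Proof. by move=> D Ed E; apply: Or42; exists l; apply: (table_alg_iso D Ed). Qed.

Lemma in_list_A l p1 p2 p3 d : d != 0 -> det3 p1 p2 p3 = d ->
  change_of_structure s p1 p2 p3 (structure_of (A_table l)) -> in_list mu.
Proof. by move=> D Ed E; apply: Or43; exists l; apply: (table_alg_iso D Ed). Qed.

Lemma in_list_DJ l p1 p2 p3 d : d != 0 -> det3 p1 p2 p3 = d ->
  change_of_structure s p1 p2 p3 (structure_of (DJ_table l)) -> in_list mu.
Proof. by move=> D Ed E; apply: Or44; exists l; apply: (table_alg_iso D Ed). Qed.

End Listing.
Arguments rebase {F V mu b s} p1 p2 p3 d {s'} C B S.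
Arguments in_list_J {F V mu b s} C B S l p1 p2 p3 d.
Arguments in_list_M {F V mu b s} C B S l p1 p2 p3 d.
Arguments in_list_A {F V mu b s} C B S l p1 p2 p3 d.
Arguments in_list_DJ {F V mu b s} C B S l p1 p2 p3 d.

Ltac coords := rewrite /det3 /smul /comb6 /comb3 /co1 /co2 /co3 /=.
Ltac check_change :=
  table_simpl; rewrite /change_of_structure; coords;
  do 2!split; congr (_, _, _); field.

(** * Completing bases, and binary quadratic forms *)

Section Bases.
Context {F : numClosedFieldType} {V : vectType F}.

Lemma nth_root (n : nat) (x : F) : (0 < n)%N -> exists y : F, x = y ^+ n.
Proof. by move=> n0; exists (n.-root x); rewrite rootCK. Qed.

Lemma nth_root_neq0 (n : nat) (x : F) : (0 < n)%N -> x != 0 ->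
  exists2 y : F, y != 0 & x = y ^+ n.
Proof.
move=> n0 x0; have [y E] := nth_root x n0; exists y => //.
by apply: contra_neq x0; rewrite E => ->; rewrite expr0n; case: n n0 {E}.
Qed.

Lemma basis3_change b p1 p2 p3 d : @basis3 F V b -> d != 0 -> @det3 F p1 p2 p3 = d ->
  @basis3 F V (lin b p1, lin b p2, lin b p3 : V).
Proof. by move=> B d0 E; apply: basis3_comb => //; rewrite E. Qed.

Definition indep2 (u v : V) := forall x y : F, x *: u + y *: v = 0 -> x = 0 /\ y = 0.

Lemma basis3_extend1 b (u : V) : @basis3 F V b -> u != 0 -> exists v w, @basis3 F V (u, v, w).
Proof.
move=> B u0; have [[[x y] z] Eu] := B.2 u.
have [x0|x0] := eqVneq x 0; last first.
  by do 2!eexists; rewrite {1}Eu; apply: (basis3_change (p2 := (0, 1, 0))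
    (p3 := (0, 0, 1)) B x0); coords; ring.
have [y0|y0] := eqVneq y 0; last first.
  by do 2!eexists; rewrite {1}Eu; apply: (basis3_change (p2 := (0, 0, 1))
    (p3 := (1, 0, 0)) B y0); coords; ring.
have [z0|z0] := eqVneq z 0; last first.
  by do 2!eexists; rewrite {1}Eu; apply: (basis3_change (p2 := (1, 0, 0))
    (p3 := (0, 1, 0)) B z0); coords; ring.
case/eqP: u0; rewrite Eu x0 y0 z0 /lin /co1 /co2 /co3 /=; vring.
Qed.

(** If one of the three minors of the coordinates of [u] and [v] is nonzero, a vector of [b]
    completes the pair; if all vanish, independence is contradicted. *)
Lemma basis3_extend2 b (u v : V) : @basis3 F V b -> indep2 u v -> exists w, @basis3 F V (u, v, w).
Proof.
move=> B I; have [p Eu] := B.2 u; have [q Ev] := B.2 v.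
move: p q Eu Ev => [[x y] z] [[x' y'] z'] Eu Ev.
have [m0|m0] := eqVneq (x * y' - y * x') 0; last first.
  by eexists; rewrite {1}Eu Ev; apply: (basis3_change (p3 := (0, 0, 1)) B m0);
  coords; ring.
have [n0|n0] := eqVneq (y * z' - z * y') 0; last first.
  by eexists; rewrite {1}Eu Ev; apply: (basis3_change (p3 := (1, 0, 0)) B n0);
  coords; ring.
have [k0|k0] := eqVneq (z * x' - x * z') 0; last first.
  by eexists; rewrite {1}Eu Ev; apply: (basis3_change (p3 := (0, 1, 0)) B k0);
  coords; ring.
have H (s t : F) : s * x + t * x' = 0 -> s * y + t * y' = 0 -> s * z + t * z' = 0 ->
    s = 0 /\ t = 0.
  move=> E1 E2 E3; apply: I; rewrite Eu Ev /lin /co1 /co2 /co3 /=.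
  transitivity ((s * x + t * x') *: b.1.1 + (s * y + t * y') *: b.1.2
    + (s * z + t * z') *: b.2); first by vring.
  by rewrite E1 E2 E3; vring.
(* With all minors zero, [x' u - x v = 0], so independence gives [x = x' = 0]; likewise for the
   other coordinates. *)
have [x0 x0'] : x = 0 /\ x' = 0.
  suff [-> /eqP] : x' = 0 /\ - x = 0 by rewrite oppr_eq0 => /eqP->.
  by apply: H; [ring | rewrite -[RHS]oppr0 -m0; ring | rewrite -[RHS]k0; ring].
have [y0 y0'] : y = 0 /\ y' = 0.
  suff [-> /eqP] : y' = 0 /\ - y = 0 by rewrite oppr_eq0 => /eqP->.
  by apply: H; [rewrite -[RHS]m0; ring | ring | rewrite -[RHS]oppr0 -n0; ring].
have [z0 z0'] : z = 0 /\ z' = 0.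
  suff [-> /eqP] : z' = 0 /\ - z = 0 by rewrite oppr_eq0 => /eqP->.
  by apply: H; [rewrite -[RHS]oppr0 -k0; ring | rewrite -[RHS]n0; ring | ring].
have [||| /eqP] := H 1 0; last by rewrite oner_eq0.
all: by rewrite ?x0 ?y0 ?z0; ring.
Qed.

Lemma quadratic_root (a b c : F) : a != 0 -> exists x, a * x ^+ 2 + 2 * b * x + c = 0.
Proof.
move=> a0; have [r E] := nth_root (b ^+ 2 - a * c) (ltn0Sn 1).
exists ((r - b) / a).
have -> : c = (b ^+ 2 - r ^+ 2) / a by rewrite -E; field.
by field.
Qed.

(** Normal form of [a X^2 + 2 b X Y + c Y^2]: there is an isotropic vector [(p, q)], and a
    complement [(r, s)] is rescaled and shifted along it. The outcomes are the zero form, rank one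
    and the hyperbolic plane. *)
Lemma binary_form (a b c : F) : exists p q r s : F, [/\ p * s - q * r != 0,
  a * p ^+ 2 + 2 * b * p * q + c * q ^+ 2 = 0
  & (a * p * r + b * (p * s + q * r) + c * q * s = 0 /\
     (a * r ^+ 2 + 2 * b * r * s + c * s ^+ 2 = 0 \/
      a * r ^+ 2 + 2 * b * r * s + c * s ^+ 2 = 1)) \/
    (a * p * r + b * (p * s + q * r) + c * q * s = 1 /\
     a * r ^+ 2 + 2 * b * r * s + c * s ^+ 2 = 0)].
Proof.
have [p [q [r [s [D E]]]]] : exists p q r s : F, p * s - q * r != 0 /\
    a * p ^+ 2 + 2 * b * p * q + c * q ^+ 2 = 0.
  have [a0|a0] := eqVneq a 0.
    by exists 1, 0, 0, 1; rewrite a0; split; [rewrite mulr0 subr0 mul1r oner_eq0 | ring].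
  have [x Ex] := quadratic_root b c a0.
  by exists x, 1, (-1), 0; split; [rewrite mulr0 sub0r mulrN1 opprK oner_eq0 | rewrite -Ex; ring].
pose m := a * p * r + b * (p * s + q * r) + c * q * s.
pose n := a * r ^+ 2 + 2 * b * r * s + c * s ^+ 2.
have [m0|m0] := eqVneq m 0.
  have [n0|n0] := eqVneq n 0; first by exists p, q, r, s; split=> //; left; split; [|left].
  have [t t0 Et] := nth_root_neq0 (ltn0Sn 1) n0.
  exists p, q, (r / t), (s / t); split=> //.
    have -> : p * (s / t) - q * (r / t) = (p * s - q * r) / t by field.
    by rewrite mulf_neq0 ?invr_eq0.
  left; split.
    have -> : a * p * (r / t) + b * (p * (s / t) + q * (r / t)) + c * q * (s / t) = m / t.
      by rewrite /m; field.
    by rewrite m0 mul0r.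
  right.
  have -> : a * (r / t) ^+ 2 + 2 * b * (r / t) * (s / t) + c * (s / t) ^+ 2 = n / t ^+ 2.
    by rewrite /n; field.
  by rewrite Et; field.
(* Adding [k (p, q)] to [(r, s)] changes its value from [n] to [n + 2 k m], since [(p, q)] is
   isotropic; this [k] makes it zero. *)
pose k := - n / (2 * m).
exists p, q, ((r + k * p) / m), ((s + k * q) / m); split=> //.
  have -> : p * ((s + k * q) / m) - q * ((r + k * p) / m) = (p * s - q * r) / m by field.
  by rewrite mulf_neq0 ?invr_eq0.
right; split.
  have -> : a * p * ((r + k * p) / m) + b * (p * ((s + k * q) / m) + q * ((r + k * p) / m))
     + c * q * ((s + k * q) / m) = (m + k * (a * p ^+ 2 + 2 * b * p * q + c * q ^+ 2)) / m.
    by rewrite [in X in _ = X / _]/m; field.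
  by rewrite E; field.
have -> : a * ((r + k * p) / m) ^+ 2 + 2 * b * ((r + k * p) / m) * ((s + k * q) / m)
    + c * ((s + k * q) / m) ^+ 2 =
  (n + 2 * k * m + k ^+ 2 * (a * p ^+ 2 + 2 * b * p * q + c * q ^+ 2)) / m ^+ 2.
  by rewrite [in X in _ = X / _]/m /n; field.
by rewrite E /k; field.
Qed.
End Bases.

Ltac solve_neq0 :=
  repeat match goal with |- is_true (_ && _) => apply/andP; split end;
  by rewrite ?(mulf_neq0, invr_neq0, expf_neq0, oppr_eq0, oner_neq0, pnatr_eq0).
Tactic Notation "change_basis" uconstr(t) :=
  refine (t _ _ _); [solve_neq0 | coords; field; solve_neq0 | check_change; solve_neq0].

(** * Algebras whose square is contained in a line or a plane *)

Section HalfPlane.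
Context {F : numClosedFieldType} {V : vectType F} (mu : {bilinear V -> V -> V}).
Hypothesis C : commutative_alg mu.

Lemma in_list_half b (a e c d p q : F) : basis3 b ->
  has_structure mu b (Structure (1, 0, 0) (0, 2^-1, 0) (a, e, 0)
    (0, 0, 0) (c, d, 0) (p, q, 0)) -> in_list mu.
Proof.
move=> B0 S0.
(* Subtracting [a e_1 + 2 e e_2] from [e_3] gives [e_1 e_3 = 0]. *)
have [b1 B1 S1] : exists2 b', basis3 b' & has_structure mu b' (Structure
    (1, 0, 0) (0, 2^-1, 0) (0, 0, 0) (0, 0, 0) (c, d - a / 2, 0)
    (p - a ^+ 2 - 4 * e * c, q - 4 * e * d, 0)).
  by apply: (rebase (1, 0, 0) (0, 1, 0) (- a, - 2 * e, 1) 1 C B0 S0);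
    [exact: oner_neq0 | coords; ring | check_change].
move: {d p q S0}(d - _) (p - _ - _) (q - _) S1 => d p q S1.
have [c0 | c0] := eqVneq c 0; last first.
  (* The automorphism adding [2 d / (3 c)] times [e_2] to [e_1], with [e_3] corrected to keep
     [e_1 e_3 = 0], removes [d]; rescaling [e_2] gives [c = 1]. *)
  have [b2 B2 S2] : exists2 b', basis3 b' & has_structure mu b' (Structure
      (1, 0, 0) (0, 2^-1, 0) (0, 0, 0) (0, 0, 0) (1, 0, 0)
      (p - 4 / 3 * d ^+ 2, c * q - 2 / 3 * p * d - 8 / 27 * d ^+ 3, 0)).
    by apply: (rebase (1, 2 * d / (3 * c), 0) (0, c^-1, 0)
        (- 2 * d / 3, - 8 * d ^+ 2 / (9 * c), 1) c^-1 C B1 S1);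
      [rewrite invr_eq0 | coords; field | check_change].
  move: {c c0 d p q S1}(p - _) (_ - _ - _) S2 => p q S2.
  (* Scaling [e_2] by [r] and [e_3] by [1 / r] keeps [e_2 e_3 = e_1] and divides [p] by [r^2] and
     [q] by [r^3]. *)
  have [p0 | p0] := eqVneq p 0; last first.
    have [r r0 Er] := nth_root_neq0 (n := 2) isT p0; rewrite {p p0}Er in S2.
    by apply: (in_list_DJ C B2 S2 (DJ01 (q / r ^+ 3)) (1, 0, 0) (0, r, 0)
      (0, 0, r^-1) 1); [exact: oner_neq0 | coords; field | check_change].
  rewrite {p}p0 in S2.
  have [q0 | q0] := eqVneq q 0.
    rewrite q0 in S2.
    by apply: (in_list_DJ C B2 S2 DJ03 (1, 0, 0) (0, 1, 0)
      (0, 0, 1) 1); [exact: oner_neq0 | coords; field | check_change].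
  have [r r0 Er] := nth_root_neq0 (n := 3) isT q0; rewrite {q q0}Er in S2.
  by apply: (in_list_DJ C B2 S2 DJ02 (1, 0, 0) (0, r, 0)
      (0, 0, r^-1) 1); [exact: oner_neq0 | coords; field | check_change].
rewrite {c}c0 in S1.
have [d0 | d0] := eqVneq d 0; last first.
  have [b2 B2 S2] : exists2 b', basis3 b' & has_structure mu b' (Structure
      (1, 0, 0) (0, 2^-1, 0) (0, 0, 0) (0, 0, 0) (0, 1, 0)
      (p / d ^+ 2, q / d ^+ 2, 0)).
    by apply: (rebase (1, 0, 0) (0, 1, 0) (0, 0, d^-1) d^-1 C B1 S1);
      [rewrite invr_eq0 | coords; field | check_change].
  move: {d p q d0 S1}(p / _) (q / _) S2 => p q S2.
  (* Replacing [e_1] by [e_1 + t e_2] and [e_3] by [e_3 - 2 t e_2] turns [q] into [q - (p + 4) t],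
     hence the exceptional value [- 4]. *)
  have [p4 | p4] := eqVneq (p + 4) 0; last first.
    by apply: (in_list_DJ C B2 S2 (DJ04 p) (1, q / (p + 4), 0) (0, 1, 0)
      (0, - 2 * q / (p + 4), 1) 1); [exact: oner_neq0 | coords; field | check_change].
  have Ep : p = - 4 by apply/eqP; rewrite -subr_eq0 opprK p4.
  rewrite Ep in S2.
  have [q0 | q0] := eqVneq q 0.
    rewrite q0 in S2.
    by apply: (in_list_DJ C B2 S2 (DJ04 (- 4)) (1, 0, 0) (0, 1, 0)
      (0, 0, 1) 1); [exact: oner_neq0 | coords; field | check_change].
  by apply: (in_list_DJ C B2 S2 DJ05 (1, 0, 0) (0, q, 0)
      (0, 0, 1) q q0); [coords; field | check_change].
rewrite {d}d0 in S1.
have [p0 | p0] := eqVneq p 0; last first.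
  have [r r0 Er] := nth_root_neq0 (n := 2) isT p0; rewrite {p p0}Er in S1.
  by apply: (in_list_DJ C B1 S1 DJ06 (1, q / r ^+ 2, 0) (0, 1, 0)
      (0, 0, r^-1) r^-1); [rewrite invr_eq0 | coords; field | check_change].
rewrite {p}p0 in S1.
have [q0 | q0] := eqVneq q 0.
  rewrite q0 in S1.
  by apply: (in_list_J C B1 S1 J18 (1, 0, 0) (0, 1, 0)
      (0, 0, 1) 1); [exact: oner_neq0 | coords; field | check_change].
by apply: (in_list_DJ C B1 S1 DJ07 (1, 0, 0) (0, q, 0)
      (0, 0, 1) q q0); [coords; field | check_change].
Qed.
End HalfPlane.

(** * Squares contained in a line *)

Section SquareInLine.
Context {F : numClosedFieldType} {V : vectType F} (mu : {bilinear V -> V -> V}).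
Hypothesis C : commutative_alg mu.

(** The product is a symmetric form times [e_1]. The cases are: [e_1] is anisotropic; it is
    isotropic but outside the radical; it lies in the radical. *)
Lemma in_list_line_structure b (k11 k12 k13 k22 k23 k33 : F) : basis3 b ->
  has_structure mu b (Structure (k11, 0, 0) (k12, 0, 0) (k13, 0, 0)
    (k22, 0, 0) (k23, 0, 0) (k33, 0, 0)) ->
  (k11, k12, k13) <> (0, 0, 0) \/ (k22, k23, k33) <> (0, 0, 0) -> in_list mu.
Proof.
move=> B S N.
have [k0|k0] := eqVneq k11 0; last first.
  (* [e_1 / k11] is idempotent, and its orthogonal complement carries a binary form. *)
  have [b1 B1 S1] : exists2 b', basis3 b' & has_structure mu b' (Structure
      (1, 0, 0) (0, 0, 0) (0, 0, 0) (k11 * k22 - k12 ^+ 2, 0, 0)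
      (k11 * k23 - k12 * k13, 0, 0) (k11 * k33 - k13 ^+ 2, 0, 0)).
    by apply: (rebase (k11^-1, 0, 0) (- k12 / k11, 1, 0) (- k13 / k11, 0, 1) k11^-1 C B S);
      [rewrite invr_eq0 | coords; ring | check_change].
  move: (k11 * k22 - _) (k11 * k23 - _) (k11 * k33 - _) S1 => a e c S1.
  have [p [q [r [s [D E1 E2]]]]] := binary_form a e c.
  have [b2 B2 S2] : exists2 b', basis3 b' & has_structure mu b' (Structure
     (1, 0, 0) (0, 0, 0) (0, 0, 0) (a * p ^+ 2 + 2 * e * p * q + c * q ^+ 2, 0, 0)
     (a * p * r + e * (p * s + q * r) + c * q * s, 0, 0)
     (a * r ^+ 2 + 2 * e * r * s + c * s ^+ 2, 0, 0)).
    by apply: (rebase (1, 0, 0) (0, p, q) (0, r, s) _ C B1 S1 D);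
      [coords; ring | check_change].
  rewrite E1 in S2.
  case: E2 => [[E2 [E3|E3]]|[E2 E3]]; rewrite E2 E3 in S2.
  - by apply: (in_list_J C B2 S2 J03 (1, 0, 0) (0, 1, 0) (0, 0, 1) 1);
      [exact: oner_neq0 | coords; ring | check_change].
  - by apply: (in_list_A C B2 S2 A30 (1, 0, 0) (0, 1, 0) (0, 0, 1) 1);
      [exact: oner_neq0 | coords; ring | check_change].
  - by apply: (in_list_A C B2 S2 A29 (1, 0, 0) (0, 1, 0) (0, 0, 1) 1);
      [exact: oner_neq0 | coords; ring | check_change].
rewrite {k11}k0 in N S.
(* Here [e_1] is isotropic and pairs with the third vector: a hyperbolic plane splits off, leaving a
   form on one vector. *)
have last2 b' k2 k3 l2 l23 l3 : k3 != 0 -> basis3 b' ->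
    has_structure mu b' (Structure (0, 0, 0) (k2, 0, 0) (k3, 0, 0)
      (l2, 0, 0) (l23, 0, 0) (l3, 0, 0)) -> in_list mu.
  move=> k0 {}B {}S.
  pose s := - (l23 / k3 - k2 * l3 / k3 ^+ 2).
  have [b1 B1 S1] : exists2 b', basis3 b' & has_structure mu b' (Structure
      (0, 0, 0) (0, 0, 0) (1, 0, 0)
      (l2 - 2 * k2 / k3 * l23 + (k2 / k3) ^+ 2 * l3, 0, 0) (0, 0, 0) (0, 0, 0)).
    by apply: (rebase (1, 0, 0) (s, 1, - k2 / k3) (- l3 / (2 * k3 ^+ 2), 0, k3^-1)
      k3^-1 C B S); [rewrite invr_eq0 | coords; ring | rewrite /s; check_change].
  move: (_ + _) S1 => m S1.
  have [m0|m0] := eqVneq m 0.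
    rewrite m0 in S1.
    by apply: (in_list_M C B1 S1 (M04 0) (1, 0, 0) (0, 1, 0) (0, 0, 1) 1);
      [exact: oner_neq0 | coords; ring | check_change].
  by apply: (in_list_M C B1 S1 M07 (m, 0, 0) (0, 1, 0) (0, 0, 1) m m0);
      [coords; ring | check_change].
have [k30|k30] := eqVneq k13 0; last exact: last2 k30 B S.
have [k20|k20] := eqVneq k12 0; last first.
  have [b1 B1 S1] : exists2 b', basis3 b' & has_structure mu b' (Structure
      (0, 0, 0) (k13, 0, 0) (k12, 0, 0) (k33, 0, 0) (k23, 0, 0) (k22, 0, 0)).
    by apply: (rebase (1, 0, 0) (0, 0, 1) (0, 1, 0) (-1) C B S);
      [rewrite oppr_eq0 oner_eq0 | coords; ring | check_change].
  exact: last2 k20 B1 S1.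
rewrite {k12}k20 {k13}k30 in N S.
have [p [q [r [s [D E1 E2]]]]] := binary_form k22 k23 k33.
have [b2 B2 S2] : exists2 b', basis3 b' & has_structure mu b' (Structure
   (0, 0, 0) (0, 0, 0) (0, 0, 0) (k22 * p ^+ 2 + 2 * k23 * p * q + k33 * q ^+ 2, 0, 0)
   (k22 * p * r + k23 * (p * s + q * r) + k33 * q * s, 0, 0)
   (k22 * r ^+ 2 + 2 * k23 * r * s + k33 * s ^+ 2, 0, 0)).
  by apply: (rebase (1, 0, 0) (0, p, q) (0, r, s) _ C B S D);
    [coords; ring | check_change].
case: E2 => [[E2 [E3|E3]]|[E2 E3]].
- case: N => [//|[]].
  (* Up to the square of the determinant, the old coefficients are combinations of the new ones, so
     a zero normal form means a zero product. *)
  suff K k : (p * s - q * r) ^+ 2 * k = 0 -> k = 0.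
    congr (_, _, _); apply: K.
    + transitivity (s ^+ 2 * (k22 * p ^+ 2 + 2 * k23 * p * q + k33 * q ^+ 2)
        - 2 * q * s * (k22 * p * r + k23 * (p * s + q * r) + k33 * q * s)
        + q ^+ 2 * (k22 * r ^+ 2 + 2 * k23 * r * s + k33 * s ^+ 2)); first by ring.
      by rewrite E1 E2 E3; ring.
    + transitivity (- r * s * (k22 * p ^+ 2 + 2 * k23 * p * q + k33 * q ^+ 2)
        + (p * s + q * r) * (k22 * p * r + k23 * (p * s + q * r) + k33 * q * s)
        - p * q * (k22 * r ^+ 2 + 2 * k23 * r * s + k33 * s ^+ 2)); first by ring.
      by rewrite E1 E2 E3; ring.
    + transitivity (r ^+ 2 * (k22 * p ^+ 2 + 2 * k23 * p * q + k33 * q ^+ 2)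
        - 2 * p * r * (k22 * p * r + k23 * (p * s + q * r) + k33 * q * s)
        + p ^+ 2 * (k22 * r ^+ 2 + 2 * k23 * r * s + k33 * s ^+ 2)); first by ring.
      by rewrite E1 E2 E3; ring.
  by move/eqP; rewrite mulf_eq0 expf_eq0 /= (negPf D) => /eqP.
- rewrite E1 E2 E3 in S2.
  by apply: (in_list_M C B2 S2 M01 (0, 0, 1) (1, 0, 0) (0, 1, 0) 1);
      [exact: oner_neq0 | coords; ring | check_change].
- rewrite E1 E2 E3 in S2.
  by apply: (in_list_M C B2 S2 M02 (0, 1, 0) (0, 0, 1) (1, 0, 0) 1);
      [exact: oner_neq0 | coords; ring | check_change].
Qed.

Lemma in_list_line b (u : V) : @basis3 F V b -> alg_nontrivial mu ->
  (forall x y, exists k, mu x y = k *: u) -> in_list mu.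
Proof.
move=> B [x [y xy0]] L.
have u0 : u != 0.
  by have [k E] := L x y; apply: contra_neq xy0; rewrite E => ->; rewrite scaler0.
have [v [w B1]] := basis3_extend1 B u0.
have R x' y' : exists k, mu x' y' = lin (u, v, w) (k, 0, 0).
  by have [k ->] := L x' y'; exists k; rewrite /lin /co1 /co2 /co3 /=; vring.
have [k11 E11] := R u u; have [k12 E12] := R u v; have [k13 E13] := R u w.
have [k22 E22] := R v v; have [k23 E23] := R v w; have [k33 E33] := R w w.
have S : has_structure mu (u, v, w) (Structure (k11, 0, 0) (k12, 0, 0) (k13, 0, 0)
    (k22, 0, 0) (k23, 0, 0) (k33, 0, 0)) by [].
apply: (in_list_line_structure B1 S).
apply: contrapT => /not_orP[/contrapT [e1 e2 e3] /contrapT [e4 e5 e6]].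
case/eqP: xy0.
have [[[x1 x2] x3] ->] := B1.2 x; have [[[y1 y2] y3] ->] := B1.2 y.
rewrite (mul_lin _ _ C S) e1 e2 e3 e4 e5 e6 /lin; coords; vring.
Qed.
End SquareInLine.

(** * Associative planes containing an idempotent *)

Section AssociativePlanes.
Context {F : numClosedFieldType} {V : vectType F} (mu : {bilinear V -> V -> V}).
Hypothesis C : commutative_alg mu.
Hypothesis N : alg_nontrivial mu.

Lemma in_list_rank1 b s (w : vec F) : @basis3 F V b -> has_structure mu b s ->
  (forall p q, exists k, smul s p q = vscale k w) -> in_list mu.
Proof.
move=> B S L; apply: (in_list_line (u := lin b w) C B N) => x y.
have [p ->] := B.2 x; have [q ->] := B.2 y.
have [k E] := L p q; exists k.
by rewrite (mul_lin _ _ C S) E /lin /vscale; coords; vring.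
Qed.

(** The plane is a product of two copies of the field. Shifting [e_3] makes [e_1 e_3] a multiple of
    [e_2] and [e_2 e_3] a multiple of [e_1]; what remains is scaling [e_3] and swapping the
    idempotents. *)
Lemma in_list_two_idempotents b (a e c d p q : F) : basis3 b ->
  has_structure mu b (Structure (1, 0, 0) (0, 0, 0) (a, e, 0)
    (0, 1, 0) (c, d, 0) (p, q, 0)) -> in_list mu.
Proof.
move=> B0 S0.
have [b1 B S] : exists2 b', basis3 b' & has_structure mu b' (Structure
    (1, 0, 0) (0, 0, 0) (0, e, 0) (0, 1, 0) (c, 0, 0)
    (p - a ^+ 2 - 2 * d * c, q - d ^+ 2 - 2 * a * e, 0)).
  change_basis (rebase (1, 0, 0) (0, 1, 0) (- a, - d, 1) 1 C B0 S0).
move: {p q S0}(p - _ - _) (q - _ - _) S => p q S.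
have [p0 | p0] := eqVneq p 0; last first.
  have [r r0 Er] := nth_root_neq0 (n := 2) isT p0; rewrite Er in S.
  change_basis (in_list_A C B S (A01 (e / r) (c / r) (q / r ^+ 2))
    (1, 0, 0) (0, 1, 0) (0, 0, r^-1) r^-1).
have [q0 | q0] := eqVneq q 0; last first.
  have [r r0 Er] := nth_root_neq0 (n := 2) isT q0; rewrite p0 Er in S.
  change_basis (in_list_A C B S (A01 (c / r) (e / r) 0)
    (0, 1, 0) (1, 0, 0) (0, 0, r^-1) (- r^-1)).
rewrite p0 q0 in S.
have [e0 | e0] := eqVneq e 0; last first.
  change_basis (in_list_A C B S (A02 (c / e)) (1, 0, 0) (0, 1, 0) (0, 0, e^-1) e^-1).
rewrite e0 in S.
have [c0 | c0] := eqVneq c 0; last first.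
  change_basis (in_list_A C B S (A02 0) (0, 1, 0) (1, 0, 0) (0, 0, c^-1) (- c^-1)).
rewrite c0 in S.
change_basis (in_list_J C B S J01 (1, 0, 0) (0, 1, 0) (0, 0, 1) 1).
Qed.

(** The plane is the algebra of dual numbers with unit [e_1]. Shifting [e_3] puts [e_1 e_3] and
    [e_2 e_3] in the line of [e_1]; afterwards only [e_2] and [e_3] are scaled. *)
Lemma in_list_dual_numbers b (a e c d p q : F) : basis3 b ->
  has_structure mu b (Structure (1, 0, 0) (0, 1, 0) (a, e, 0)
    (0, 0, 0) (c, d, 0) (p, q, 0)) -> in_list mu.
Proof.
move=> B0 S0.
have [b1 B S] : exists2 b', basis3 b' & has_structure mu b' (Structure
    (1, 0, 0) (0, 1, 0) (a - d, 0, 0) (0, 0, 0) (c, 0, 0)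
    (p - 2 * a * d - 2 * e * c + d ^+ 2, q - 2 * d * e, 0)).
  change_basis (rebase (1, 0, 0) (0, 1, 0) (- d, - e, 1) 1 C B0 S0).
move: {a p q S0}(a - _) (p - _ - _ + _) (q - _) S => a p q S.
have [a0 | a0] := eqVneq a 0; last first.
  have [q0 | q0] := eqVneq q 0; last first.
    change_basis (in_list_A C B S (A12 (q * c / a ^+ 3) (p / a ^+ 2))
      (1, 0, 0) (0, q / a ^+ 2, 0) (0, 0, a^-1) (q / a ^+ 2 * a^-1)).
  rewrite q0 in S.
  have [c0 | c0] := eqVneq c 0; last first.
    change_basis (in_list_A C B S (A13 (p / a ^+ 2))
      (1, 0, 0) (0, a / c, 0) (0, 0, a^-1) (c^-1)).
  rewrite c0 in S.
  change_basis (in_list_A C B S (A14 (p / a ^+ 2))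
      (1, 0, 0) (0, 1, 0) (0, 0, a^-1) (a^-1)).
rewrite a0 in S.
have [p0 | p0] := eqVneq p 0; last first.
  have [r r0 Er] := nth_root_neq0 (n := 2) isT p0; rewrite Er in S.
  have [c0 | c0] := eqVneq c 0; last first.
    change_basis (in_list_A C B S (A15 (q * c / r ^+ 3))
      (1, 0, 0) (0, r / c, 0) (0, 0, r^-1) (c^-1)).
  rewrite c0 in S.
  have [q0 | q0] := eqVneq q 0; last first.
    change_basis (in_list_A C B S A16
      (1, 0, 0) (0, q / r ^+ 2, 0) (0, 0, r^-1) (q / r ^+ 2 * r^-1)).
  rewrite q0 in S.
  change_basis (in_list_A C B S A17 (1, 0, 0) (0, 1, 0) (0, 0, r^-1) (r^-1)).
rewrite p0 in S.
have [c0 | c0] := eqVneq c 0; last first.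
  have [q0 | q0] := eqVneq q 0; last first.
    (* With [e_2] scaled by [r / c] and [e_3] by [1 / r], the product [e_3 e_3] equals [e_2] exactly
       when [r^3 = q c]. *)
    have [r r0 Er] := nth_root_neq0 (n := 3) isT (mulf_neq0 q0 c0).
    have {}Er : q = r ^+ 3 / c by rewrite -Er; field.
    rewrite Er in S.
    change_basis (in_list_A C B S A18
      (1, 0, 0) (0, r / c, 0) (0, 0, r^-1) (c^-1)).
  rewrite q0 in S.
  change_basis (in_list_A C B S A19 (1, 0, 0) (0, c^-1, 0) (0, 0, 1) (c^-1)).
rewrite c0 in S.
have [q0 | q0] := eqVneq q 0; last first.
  change_basis (in_list_A C B S A20 (1, 0, 0) (0, q, 0) (0, 0, 1) q).
rewrite q0 in S.
change_basis (in_list_J C B S J02 (1, 0, 0) (0, 1, 0) (0, 0, 1) 1).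
Qed.

(** The plane is an idempotent line plus a null line. Adding a multiple of [e_2] to [e_3] can remove
    from [e_3 e_3] the coefficient of [e_2] if [d] is nonzero, and that of [e_1] if [d = 0] and [c]
    is nonzero. *)
Lemma in_list_one_idempotent b (a e c d p q : F) : basis3 b ->
  has_structure mu b (Structure (1, 0, 0) (0, 0, 0) (a, e, 0)
    (0, 0, 0) (c, d, 0) (p, q, 0)) -> in_list mu.
Proof.
move=> B0 S0.
have [b1 B S] : exists2 b', basis3 b' & has_structure mu b' (Structure
    (1, 0, 0) (0, 0, 0) (0, e, 0) (0, 0, 0) (c, d, 0)
    (p - a ^+ 2, q - 2 * a * e, 0)).
  change_basis (rebase (1, 0, 0) (0, 1, 0) (- a, 0, 1) 1 C B0 S0).
move: {p q S0}(p - _) (q - _) S => p q S.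
have [e0 | e0] := eqVneq e 0.
  rewrite e0 in S.
  have [d0 | d0] := eqVneq d 0; last first.
    have [c0 | c0] := eqVneq c 0; last first.
      change_basis (in_list_A C B S (A04 (p / d ^+ 2 - q * c / d ^+ 3))
        (1, 0, 0) (0, d / c, 0) (0, - q / (2 * d ^+ 2), d^-1) c^-1).
    rewrite c0 in S.
    change_basis (in_list_A C B S (A03 (p / d ^+ 2))
        (1, 0, 0) (0, 1, 0) (0, - q / (2 * d ^+ 2), d^-1) d^-1).
  rewrite d0 in S.
  have [q0 | q0] := eqVneq q 0.
    rewrite q0 in S.
    apply: (in_list_rank1 (w := (1, 0, 0)) B S) => -[[x1 x2] x3] [[y1 y2] y3].
    exists (x1 * y1 + (x2 * y3 + x3 * y2) * c + x3 * y3 * p).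
    by rewrite /vscale; coords; congr (_, _, _); ring.
  have [c0 | c0] := eqVneq c 0; last first.
    have [r r0 Er] := nth_root_neq0 (n := 3) isT (mulf_neq0 q0 c0).
    have {}Er : q = r ^+ 3 / c by rewrite -Er; field.
    rewrite Er in S.
    change_basis (in_list_A C B S A10
      (1, 0, 0) (0, r / c, 0) (0, - p / (2 * r * c), r^-1) (c^-1)).
  rewrite c0 in S.
  have [p0 | p0] := eqVneq p 0; last first.
    have [r r0 Er] := nth_root_neq0 (n := 2) isT p0; rewrite Er in S.
    change_basis (in_list_A C B S A11
      (1, 0, 0) (0, q / r ^+ 2, 0) (0, 0, r^-1) (q / r ^+ 2 / r)).
  rewrite p0 in S.
  change_basis (in_list_J C B S J11 (1, 0, 0) (0, 0, 1) (0, q, 0) (- q)).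
have [d0 | d0] := eqVneq d 0; last first.
  change_basis (in_list_A C B S (A05 (e * c / d ^+ 2) (p / d ^+ 2 - q * c / d ^+ 3))
    (1, 0, 0) (0, e / d, 0) (0, - q / (2 * d ^+ 2), d^-1) (e / d / d)).
rewrite d0 in S.
have [c0 | c0] := eqVneq c 0; last first.
  have [r r0 Er] := nth_root_neq0 (n := 2) isT (mulf_neq0 e0 c0).
  have {}Er : c = r ^+ 2 / e by rewrite -Er; field.
  rewrite Er in S.
  change_basis (in_list_A C B S (A06 (q / (e * r)))
    (1, 0, 0) (0, e / r, 0) (0, - p * e / (2 * r ^+ 3), r^-1) (e / r / r)).
rewrite c0 in S.
have [p0 | p0] := eqVneq p 0; last first.
  have [r r0 Er] := nth_root_neq0 (n := 2) isT p0; rewrite Er in S.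
  change_basis (in_list_A C B S (A09 (q / (e * r)))
    (1, 0, 0) (0, e / r, 0) (0, 0, r^-1) (e / r / r)).
rewrite p0 in S.
have [q0 | q0] := eqVneq q 0; last first.
  change_basis (in_list_A C B S A08
    (1, 0, 0) (0, e ^+ 2 / q, 0) (0, 0, e / q) (e ^+ 2 / q * (e / q))).
rewrite q0 in S.
change_basis (in_list_A C B S A07 (1, 0, 0) (0, e, 0) (0, 0, 1) e).
Qed.
End AssociativePlanes.

(** * Planes with nilpotent or zero product *)

Section NilpotentPlanes.
Context {F : numClosedFieldType} {V : vectType F} (mu : {bilinear V -> V -> V}).
Hypothesis C : commutative_alg mu.
Hypothesis N : alg_nontrivial mu.

Lemma in_list_nilpotent b (a e c d p q : F) : basis3 b ->
  has_structure mu b (Structure (0, 1, 0) (0, 0, 0) (a, e, 0)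
    (0, 0, 0) (c, d, 0) (p, q, 0)) -> in_list mu.
Proof.
have [c0 | c0] := eqVneq c 0; last first.
  (* Replacing [e_1] by [e_1 - (a / c) e_2] removes the [e_1] part of [e_1 e_3]. *)
  wlog a0 : a e d p q b / a = 0 => [W | ] B0 S0.
    have [b1 B S] : exists2 b', basis3 b' & has_structure mu b' (Structure
        (0, 1, 0) (0, 0, 0) (0, e - a * d / c, 0) (0, 0, 0) (c, d + a, 0)
        (p, q + p * a / c, 0)).
      change_basis (rebase (1, - a / c, 0) (0, 1, 0) (0, 0, 1) 1 C B0 S0).
    exact: W B S.
  rewrite a0 in S0.
  have [b1 B S] : exists2 b', basis3 b' & has_structure mu b' (Structure
      (0, 1, 0) (0, 0, 0) (0, 0, 0) (0, 0, 0) (c, d, 0)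
      (0, q - e ^+ 2 - p * d / c, 0)).
    change_basis (rebase (1, 0, 0) (0, 1, 0) (- e, - p / (2 * c), 1) 1 C B0 S0).
  move: {q S0}(q - _ - _) S => q S.
  have [d0 | d0] := eqVneq d 0; last first.
    change_basis (in_list_A C B S (A21 (q * c ^+ 2 / d ^+ 4))
      (d / c, 0, 0) (0, (d / c) ^+ 2, 0) (0, 0, d^-1) ((d / c) ^+ 2 / c)).
  rewrite d0 in S.
  have [q0 | q0] := eqVneq q 0; last first.
    (* For the scalings [r], [r^2], [1 / (r c)], the condition [e_3 e_3 = e_2] reads
       [q = r^4 c^2]. *)
    have [r r0 Er] := nth_root_neq0 (n := 4) isT
      (mulf_neq0 q0 (invr_neq0 (expf_neq0 2 c0))).
    have {}Er : q = r ^+ 4 * c ^+ 2 by rewrite -Er; field.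
    rewrite Er in S.
    change_basis (in_list_A C B S A23
      (r, 0, 0) (0, r ^+ 2, 0) (0, 0, (r * c)^-1) (r ^+ 2 / c)).
  rewrite q0 in S.
  change_basis (in_list_A C B S A22 (1, 0, 0) (0, 1, 0) (0, 0, c^-1) c^-1).
rewrite {c}c0 => B0 S0.
have [a0 | a0] := eqVneq a 0.
  rewrite a0 in S0.
  have [b1 B S] : exists2 b', basis3 b' & has_structure mu b' (Structure
      (0, 1, 0) (0, 0, 0) (0, 0, 0) (0, 0, 0) (0, d, 0) (p, q - e ^+ 2, 0)).
    change_basis (rebase (1, 0, 0) (0, 1, 0) (- e, 0, 1) 1 C B0 S0).
  move: {q S0}(q - _) S => q S.
  have [p0 | p0] := eqVneq p 0.
    rewrite p0 in S.
    apply: (in_list_rank1 C N (w := (0, 1, 0)) B S) => -[[x1 x2] x3] [[y1 y2] y3].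
    exists (x1 * y1 + (x2 * y3 + x3 * y2) * d + x3 * y3 * q).
    by rewrite /vscale; coords; congr (_, _, _); ring.
  have [d0 | d0] := eqVneq d 0; last first.
    change_basis (in_list_A C B S A28 (p / d ^+ 2, 0, 0) (0, (p / d ^+ 2) ^+ 2, 0)
      (0, - q / (2 * d ^+ 2), d^-1) ((p / d ^+ 2) ^+ 3 / d)).
  rewrite d0 in S.
  change_basis (in_list_A C B S A27 (p, q, 0) (0, p ^+ 2, 0) (0, 0, 1) (p ^+ 3)).
have [b1 B1 S1] : exists2 b', basis3 b' & has_structure mu b' (Structure
    (0, 1, 0) (0, 0, 0) (1, 0, 0) (0, 0, 0) (0, d / a, 0)
    (p / a ^+ 2 - 2 * e / a, q / a ^+ 2 - (e / a) ^+ 2, 0)).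
  change_basis (rebase (1, 0, 0) (0, 1, 0) (- e / a, 0, a^-1) a^-1 C B0 S0).
move: {a a0 d p q S0}(d / a) (p / _ - _) (q / _ - _) S1 => d p q S1.
(* Subtracting [(p / 2) e_1] from [e_3] removes [p] but adds [- (p / 2) e_2] to [e_1 e_3]. A shift
   of [e_1] along [e_2] absorbs that term when [d] differs from 1; when [d = 1] it survives as
   [A26]. *)
have [d1 | d1] := eqVneq d 1.
  rewrite d1 in S1.
  have [p0 | p0] := eqVneq p 0.
    rewrite p0 in S1.
    change_basis (in_list_A C B1 S1 (A24 1) (1, 0, 0) (0, 1, 0) (0, - q / 2, 1) 1).
  change_basis (in_list_A C B1 S1 A26 (- p / 2, 0, 0) (0, (- p / 2) ^+ 2, 0)
    (- p / 2, - (q + (- p / 2) ^+ 2) / 2, 1) ((- p / 2) ^+ 3)).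
have {}d1 : 1 - d != 0 by rewrite subr_eq0 eq_sym.
have [b2 B S] : exists2 b', basis3 b' & has_structure mu b' (Structure
    (0, 1, 0) (0, 0, 0) (1, 0, 0) (0, 0, 0) (0, d, 0) (0, q + (p / 2) ^+ 2, 0)).
  change_basis (rebase (1, - p / 2 / (1 - d), 0) (0, 1, 0) (- p / 2, 0, 1) 1 C B1 S1).
move: {p q S1}(q + _) S => q S.
have [d0 | d0] := eqVneq d 0; last first.
  change_basis (in_list_A C B S (A24 d) (1, 0, 0) (0, 1, 0) (0, - q / (2 * d), 1) 1).
rewrite d0 in S.
have [q0 | q0] := eqVneq q 0.
  rewrite q0 in S.
  change_basis (in_list_A C B S (A24 0) (1, 0, 0) (0, 1, 0) (0, 0, 1) 1).
have [r r0 Er] := nth_root_neq0 (n := 2) isT q0; rewrite Er in S.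
change_basis (in_list_A C B S A25 (r, 0, 0) (0, r ^+ 2, 0) (0, 0, 1) (r ^+ 3)).
Qed.

Lemma monic_quadratic_split (s t : F) : exists x y : F, s = x + y /\ t = x * y.
Proof.
have [r E] := nth_root (s ^+ 2 / 4 - t) (ltn0Sn 1).
exists (s / 2 + r), (s / 2 - r); split; first by field.
have -> : t = s ^+ 2 / 4 - r ^+ 2 by rewrite -E; ring.
by field.
Qed.

(** Multiplication by [e_3] on the plane is triangular with eigenvalues [x] and [y]. It is
    diagonalised if they differ; a Jordan block gives [M06] or, for eigenvalue zero, [M03] unless
    all products lie in a line. *)
Lemma in_list_triangular b (x z y p q : F) : basis3 b ->
  has_structure mu b (Structure (0, 0, 0) (0, 0, 0) (x, 0, 0)
    (0, 0, 0) (z, y, 0) (p, q, 0)) -> in_list mu.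
Proof.
move=> B0 S0.
have diag b' u v m n : u != 0 -> basis3 b' ->
    has_structure mu b' (Structure (0, 0, 0) (0, 0, 0) (u, 0, 0)
      (0, 0, 0) (0, v, 0) (m, n, 0)) -> in_list mu.
  move=> u0 B S.
  have [v0 | v0] := eqVneq v 0; last first.
    change_basis (in_list_M C B S (M04 (v / u)) (1, 0, 0) (0, 1, 0)
      (- m / (2 * u ^+ 2), - n / (2 * u * v), u^-1) u^-1).
  rewrite v0 in S.
  have [n0 | n0] := eqVneq n 0; last first.
    change_basis (in_list_M C B S M05 (1, 0, 0) (0, n / u ^+ 2, 0)
      (- m / (2 * u ^+ 2), 0, u^-1) (n / u ^+ 2 / u)).
  rewrite n0 in S.
  change_basis (in_list_M C B S (M04 0) (1, 0, 0) (0, 1, 0)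
      (- m / (2 * u ^+ 2), 0, u^-1) u^-1).
have [Exy | Dxy] := eqVneq y x; last first.
  have {}Dxy : y - x != 0 by rewrite subr_eq0.
  have [b1 B1 S1] : exists2 b', basis3 b' & has_structure mu b' (Structure
      (0, 0, 0) (0, 0, 0) (x, 0, 0) (0, 0, 0) (0, y, 0)
      (p - q * z / (y - x), q, 0)).
    change_basis (rebase (1, 0, 0) (z / (y - x), 1, 0) (0, 0, 1) 1 C B0 S0).
  have [x0 | x0] := eqVneq x 0; last exact: diag x0 B1 S1.
  rewrite x0 subr0 in S1 Dxy.
  have [b2 B2 S2] : exists2 b', basis3 b' & has_structure mu b' (Structure
      (0, 0, 0) (0, 0, 0) (y, 0, 0) (0, 0, 0) (0, 0, 0)
      (q, p - q * z / y, 0)).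
    change_basis (rebase (0, 1, 0) (1, 0, 0) (0, 0, 1) (- 1) C B1 S1).
  exact: diag Dxy B2 S2.
rewrite Exy in S0.
have [x0 | x0] := eqVneq x 0; last first.
  have [z0 | z0] := eqVneq z 0; first by rewrite z0 in S0; apply: diag x0 B0 S0.
  change_basis (in_list_M C B0 S0 M06 (0, 1, 0) (z / x, 0, 0)
    (- p / (2 * x ^+ 2) + z * q / (2 * x ^+ 3), - q / (2 * x ^+ 2), x^-1) (- (z / x / x))).
rewrite x0 in S0.
have [z0 | z0] := eqVneq z 0.
  rewrite z0 in S0.
  apply: (in_list_rank1 C N (w := (p, q, 0)) B0 S0) => -[[x1 x2] x3] [[y1 y2] y3].
  by exists (x3 * y3); rewrite /vscale; coords; congr (_, _, _); ring.
have [q0 | q0] := eqVneq q 0.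
  rewrite q0 in S0.
  apply: (in_list_rank1 C N (w := (1, 0, 0)) B0 S0) => -[[x1 x2] x3] [[y1 y2] y3].
  exists ((x2 * y3 + x3 * y2) * z + x3 * y3 * p).
  by rewrite /vscale; coords; congr (_, _, _); ring.
change_basis (in_list_M C B0 S0 M03 (0, 0, 1) (p, q, 0) (q * z, 0, 0) (- (q * (q * z)))).
Qed.

Lemma in_list_trivial_square b (a e c d p q : F) : basis3 b ->
  has_structure mu b (Structure (0, 0, 0) (0, 0, 0) (a, e, 0)
    (0, 0, 0) (c, d, 0) (p, q, 0)) -> in_list mu.
Proof.
move=> B S.
have [c0 | c0] := eqVneq c 0.
  rewrite c0 in S.
  have [b1 B1 S1] : exists2 b', basis3 b' & has_structure mu b' (Structure
      (0, 0, 0) (0, 0, 0) (d, 0, 0) (0, 0, 0) (e, a, 0) (q, p, 0)).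
    change_basis (rebase (0, 1, 0) (1, 0, 0) (0, 0, 1) (- 1) C B S).
  exact: in_list_triangular B1 S1.
(* The eigenvalues of multiplication by [e_3] on the plane; below, [c e_1 + (x - a) e_2] is an
   eigenvector for [x]. *)
have [x [y [E1 E2]]] := monic_quadratic_split (a + d) (a * d - e * c).
have Ed : d = x + y - a by rewrite -E1; ring.
have Ee : e = (a * d - x * y) / c by rewrite -E2; field.
rewrite Ee Ed in S.
have [b1 B1 S1] : exists2 b', basis3 b' & has_structure mu b' (Structure
    (0, 0, 0) (0, 0, 0) (x, 0, 0) (0, 0, 0) (1, y, 0)
    (p / c, q - p * (x - a) / c, 0)).
  change_basis (rebase (c, x - a, 0) (0, 1, 0) (0, 0, 1) c C B S).
exact: in_list_triangular B1 S1.
Qed.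
End NilpotentPlanes.

(** * Squares contained in a plane *)

Section SquareInPlane.
Context {F : numClosedFieldType} {V : vectType F} (mu : {bilinear V -> V -> V}).
Hypothesis C : commutative_alg mu.
Hypothesis N : alg_nontrivial mu.

Definition square_in_plane (b : V * V * V) :=
  forall x y, exists m n : F, mu x y = lin b (m, n, 0).

Definition plane_structure (b : V * V * V) (a1 a2 b1 b2 g1 g2 : F) :=
  [/\ mu b.1.1 b.1.1 = lin b (a1, a2, 0), mu b.1.1 b.1.2 = lin b (b1, b2, 0)
    & mu b.1.2 b.1.2 = lin b (g1, g2, 0)].

Lemma plane_has_structure (b : V * V * V) (a1 a2 b1 b2 g1 g2 : F) :
  square_in_plane b -> plane_structure b a1 a2 b1 b2 g1 g2 ->
  exists a e c d p q, has_structure mu b (Structure (a1, a2, 0) (b1, b2, 0) (a, e, 0)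
    (g1, g2, 0) (c, d, 0) (p, q, 0)).
Proof.
case: b => [[u v] w] Q [E1 E2 E3].
have [a [e Ea]] := Q u w; have [c [d Ec]] := Q v w; have [p [q Ep]] := Q w w.
by exists a, e, c, d, p, q.
Qed.

Lemma plane_change (b : V * V * V) x1 y1 x2 y2 d :
  @basis3 F V b -> square_in_plane b -> d != 0 -> x1 * y2 - y1 * x2 = d ->
  let b' := (lin b (x1, y1, 0), lin b (x2, y2, 0), lin b (0, 0, 1)) in
  @basis3 F V b' /\ square_in_plane b'.
Proof.
move=> B Q d0 E b'.
have D : @det3 F (x1, y1, 0) (x2, y2, 0) (0, 0, 1) = d by rewrite -E; coords; ring.
split=> [|x y]; first exact: basis3_change d0 D.
have [m [n ->]] := Q x y.
exists ((m * y2 - n * x2) / d), ((n * x1 - m * y1) / d).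
have Ed : y1 * x2 = x1 * y2 - d by rewrite -E; ring.
rewrite /b' lin_comb; congr lin; coords.
congr (_, _, _); rewrite -?E; field; by rewrite E.
Qed.

(** Products with the third vector are left existential, as the normal form lemmas accept any values
    for them. The zeros in [s] are placeholders: only products within the plane are evaluated. *)
Lemma rebase_plane (b : V * V * V) (a1 a2 b1 b2 g1 g2 : F) x1 y1 x2 y2 d a1' a2' b1' b2' g1' g2' :
  @basis3 F V b -> square_in_plane b -> plane_structure b a1 a2 b1 b2 g1 g2 ->
  d != 0 -> x1 * y2 - y1 * x2 = d ->
  let s := Structure (a1, a2, 0) (b1, b2, 0) (0, 0, 0) (g1, g2, 0) (0, 0, 0) (0, 0, 0) in
  let p1 := (x1, y1, 0) in let p2 := (x2, y2, 0) in let p3 := (0, 0, 1) in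
  [/\ smul s p1 p1 = comb3 p1 p2 p3 (a1', a2', 0),
      smul s p1 p2 = comb3 p1 p2 p3 (b1', b2', 0)
    & smul s p2 p2 = comb3 p1 p2 p3 (g1', g2', 0)] ->
  exists b', exists a e c d' p q, @basis3 F V b' /\
    has_structure mu b' (Structure (a1', a2', 0) (b1', b2', 0) (a, e, 0)
    (g1', g2', 0) (c, d', 0) (p, q, 0)).
Proof.
move=> B Q P d0 E s p1 p2 p3 [E1 E2 E3].
have [a [e [c [d' [p [q S]]]]]] := plane_has_structure Q P.
have [B' Q'] := plane_change B Q d0 E.
exists (lin b (x1, y1, 0), lin b (x2, y2, 0), lin b (0, 0, 1)).
have R x y x' y' r : smul s (x, y, 0) (x', y', 0) = r ->
    mu (lin b (x, y, 0)) (lin b (x', y', 0)) = lin b r.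
  by move=> <-; rewrite (mul_lin _ _ C S); congr lin; coords; congr (_, _, _); ring.
have P' : plane_structure (lin b (x1, y1, 0), lin b (x2, y2, 0), lin b (0, 0, 1))
    a1' a2' b1' b2' g1' g2'.
  by split; rewrite lin_comb; apply: R.
have [a' [e' [c' [d'' [p' [q' S']]]]]] := plane_has_structure Q' P'.
by exists a', e', c', d'', p', q'.
Qed.

(* The basis is [x, x ^ 2] with [x ^ 3 = (r + s) x ^ 2 - r s x]. *)
Lemma in_list_monogenic_plane (b : V * V * V) r s : @basis3 F V b -> square_in_plane b ->
  plane_structure b 0 1 (- (r * s)) (r + s)
    (- (r * s) * (r + s)) ((r + s) ^+ 2 - r * s) ->
  in_list mu.
Proof.
(* By symmetry a zero root is named [r], so that [s = 0] only if both vanish. *)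
wlog: r s / (s == 0) ==> (r == 0) => [W B Q P | H B Q P].
  have [s0 | s0] := eqVneq s 0; last by apply: W B Q P; rewrite (negPf s0).
  apply: (W s r) B Q _; first by rewrite s0 eqxx implybT.
  by rewrite (mulrC s) (addrC s).
have [r0 | r0] := eqVneq r 0.
  rewrite {}r0 in P.
  have [s0 | s0] := eqVneq s 0.
    have [a [e [c [d [p [q S]]]]]] := plane_has_structure Q P.
    apply: (in_list_nilpotent C N (a := a) (e := e) (c := c) (d := d) (p := p) (q := q) B).
    by rewrite s0 !(mul0r, oppr0, addr0, expr0n) /= in S.
  have [b' [a [e [c [d [p [q [B' S']]]]]]]] : exists b', exists a e c d' p q, @basis3 F V b' /\
    has_structure mu b' (Structure (1, 0, 0) (0, 0, 0) (a, e, 0)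
    (0, 0, 0) (c, d', 0) (p, q, 0)).
    (* [x^2 / s^2] is idempotent, and [x^2 - s x] annihilates the plane. *)
    apply: (rebase_plane (x1 := 0) (y1 := s ^- 2) (x2 := - s) (y2 := 1) (d := s^-1) B Q P).
    - solve_neq0.
    - field; solve_neq0.
    - by split; coords; congr (_, _, _); field; solve_neq0.
  exact: in_list_one_idempotent B' S'.
have s0 : s != 0 by apply: contra r0; apply/implyP.
have [rs | rs] := eqVneq (r - s) 0.
  have {}rs : s = r by apply/eqP; rewrite eq_sym -subr_eq0 rs.
  rewrite rs in P.
  have [b' [a [e [c [d [p [q [B' S']]]]]]]] : exists b', exists a e c d' p q, @basis3 F V b' /\
    has_structure mu b' (Structure (1, 0, 0) (0, 1, 0) (a, e, 0)
    (0, 0, 0) (c, d', 0) (p, q, 0)).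
    (* The unit [1 - (1 - x / r)^2] of the plane and the nilpotent [x^2 / r - x]. *)
    apply: (rebase_plane (x1 := 2 / r) (y1 := - r ^- 2) (x2 := -1) (y2 := r^-1)
      (d := r ^- 2) B Q P).
    - solve_neq0.
    - field; solve_neq0.
    - by split; coords; congr (_, _, _); field; solve_neq0.
  exact: in_list_dual_numbers B' S'.
have [b' [a [e [c [d [p [q [B' S']]]]]]]] : exists b', exists a e c d' p q, @basis3 F V b' /\
    has_structure mu b' (Structure (1, 0, 0) (0, 0, 0) (a, e, 0)
    (0, 1, 0) (c, d', 0) (p, q, 0)).
  have sr : s - r != 0 by rewrite -opprB oppr_eq0.
  (* Lagrange idempotents: quadratic polynomials in [x] without constant term, equal to one at one
     root and zero at the other. *)
  apply: (rebase_plane (x1 := - s / (r * (r - s))) (y1 := (r * (r - s))^-1)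
    (x2 := - r / (s * (s - r))) (y2 := (s * (s - r))^-1)
      (d := (r * s * (s - r))^-1) B Q P).
    - solve_neq0.
    - field; solve_neq0.
    - by split; coords; congr (_, _, _); field; solve_neq0.
exact: in_list_two_idempotents B' S'.
Qed.

Definition fourth_power_assoc (b : V * V * V) := forall x y : F,
  let z := lin b (x, y, 0) in mu (mu z z) (mu z z) = mu (mu (mu z z) z) z.

(** The determinant condition makes [z] and [z^2] independent. With [z^3 = al z + be z^2], fourth
    power associativity determines [z^2 z^2]. *)
Lemma in_list_plane_monogenic (b : V * V * V) x y m n : @basis3 F V b -> square_in_plane b ->
  fourth_power_assoc b -> mu (lin b (x, y, 0)) (lin b (x, y, 0)) = lin b (m, n, 0) ->
  x * n - y * m != 0 -> in_list mu.
Proof.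
move=> B Q PA E D; have [B' Q'] := plane_change B Q D erefl.
have := PA x y; rewrite /= E.
set z := lin b (x, y, 0) in E B' Q' *; set z2 := lin b (m, n, 0) in E B' Q' *.
set w := lin b _ in B' Q' => {}PA.
have [al [be Ez]] := Q' z z2; rewrite (C z2 z) Ez in PA.
have [r [s [Er Es]]] := monic_quadratic_split be (- al).
apply: (in_list_monogenic_plane (r := r) (s := s) B' Q').
have Ez2 : mu z z2 = al *: z + be *: z2 by rewrite Ez /lin /co1 /co2 /co3 /=; vring.
split=> /=; rewrite -?Es -?Er ?opprK //.
- by rewrite E /lin /co1 /co2 /co3 /=; vring.
- rewrite PA /lin /co1 /co2 /co3 /= scale0r addr0 linearDl !linearZl_LR E (C z2) Ez2 /=.
  by vring.
Qed.

(* The cubic form measuring how far [z ^ 2] is from being proportional to [z]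
   in a plane algebra vanishes as soon as it vanishes at four points. *)
Lemma binary_algebra_alternative (a1 a2 b1 b2 g1 g2 : F) :
  (exists x y, x * (a2 * x ^+ 2 + 2 * b2 * x * y + g2 * y ^+ 2)
    - y * (a1 * x ^+ 2 + 2 * b1 * x * y + g1 * y ^+ 2) != 0) \/
  a1 = 2 * b2 /\ a2 = 0 /\ g1 = 0 /\ g2 = 2 * b1.
Proof.
pose k x y := x * (a2 * x ^+ 2 + 2 * b2 * x * y + g2 * y ^+ 2)
    - y * (a1 * x ^+ 2 + 2 * b1 * x * y + g1 * y ^+ 2).
have [K1|] := eqVneq (k 1 0) 0; last by left; exists 1, 0.
have [K2|] := eqVneq (k 0 1) 0; last by left; exists 0, 1.
have [K3|] := eqVneq (k 1 1) 0; last by left; exists 1, 1.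
have [K4|] := eqVneq (k 1 (- 1)) 0; last by left; exists 1, (- 1).
right.
have a20 : a2 = 0 by rewrite -K1 /k; ring.
have g10 : g1 = 0 by rewrite -[g1]opprK -[RHS]oppr0 -K2 /k; ring.
split; last split=> //; last split=> //; apply/eqP; rewrite -subr_eq0; apply/eqP.
- transitivity ((k 1 (- 1) - k 1 1) / 2); first by rewrite /k g10; field.
  by rewrite K3 K4; field.
- transitivity ((k 1 (- 1) + k 1 1) / 2); first by rewrite /k a20; field.
  by rewrite K3 K4; field.
Qed.

Lemma in_list_plane (b : V * V * V) : @basis3 F V b -> square_in_plane b -> fourth_power_assoc b ->
  in_list mu.
Proof.
move=> B Q PA.
have [a1 [a2 E11]] := Q b.1.1 b.1.1; have [b1 [b2 E12]] := Q b.1.1 b.1.2.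
have [g1 [g2 E22]] := Q b.1.2 b.1.2.
have P : plane_structure b a1 a2 b1 b2 g1 g2 by [].
have [a [e [c [d [p [q S]]]]]] := plane_has_structure Q P.
have A : a1 = 2 * b2 /\ a2 = 0 /\ g1 = 0 /\ g2 = 2 * b1 \/ in_list mu.
  have [[x [y D]]|?] := binary_algebra_alternative a1 a2 b1 b2 g1 g2; last by left.
  right; apply: in_list_plane_monogenic B Q PA _ D.
  by rewrite (mul_lin _ _ C S); congr lin; coords; congr (_, _, _); ring.
case: A => [[a1b [a20 [g10 g2b]]]|//].
rewrite {a1}a1b {a2}a20 {g1}g10 {g2}g2b in P S {E11 E22}.
(* Now [z^2 = f(z) z] with [f = 2 (b2 x + b1 y)]. If [f] is nonzero, the new basis has a first
   vector with [f = 1] and a second one in the kernel of [f]. *)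
have [b20 | b20] := eqVneq b2 0; last first.
  have [b' [a' [e' [c' [d' [p' [q' [B' S']]]]]]]] : exists b', exists a e c d' p q, @basis3 F V b' /\
    has_structure mu b' (Structure (1, 0, 0) (0, 2^-1, 0) (a, e, 0)
    (0, 0, 0) (c, d', 0) (p, q, 0)).
    apply: (rebase_plane (x1 := (2 * b2)^-1) (y1 := 0) (x2 := - b1 / b2) (y2 := 1)
      (d := (2 * b2)^-1) B Q P).
    - solve_neq0.
    - field; solve_neq0.
    - by split; coords; congr (_, _, _); field; solve_neq0.
  exact: in_list_half B' S'.
rewrite b20 in P S.
have [b10 | b10] := eqVneq b1 0; last first.
  have [b' [a' [e' [c' [d' [p' [q' [B' S']]]]]]]] : exists b', exists a e c d' p q, @basis3 F V b' /\
    has_structure mu b' (Structure (1, 0, 0) (0, 2^-1, 0) (a, e, 0)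
    (0, 0, 0) (c, d', 0) (p, q, 0)).
    apply: (rebase_plane (x1 := 0) (y1 := (2 * b1)^-1) (x2 := 1) (y2 := 0)
      (d := - (2 * b1)^-1) B Q P).
    - solve_neq0.
    - field; solve_neq0.
    - by split; coords; congr (_, _, _); field; solve_neq0.
  exact: in_list_half B' S'.
rewrite b10 !mulr0 in S.
exact: in_list_trivial_square B S.
Qed.
End SquareInPlane.

(** * Jordan algebras *)

Section UnitalAlgebras.
Context {F : numClosedFieldType} {V : vectType F} (mu : {bilinear V -> V -> V}).
Hypothesis C : commutative_alg mu.
Local Notation "x ** y" := (mu x y) (at level 40, left associativity).

Lemma linear_combination3 (k1 k2 k3 d1 d2 d3 a : F) :
  d1 = 0 -> d2 = 0 -> d3 = 0 -> a = k1 * d1 + k2 * d2 + k3 * d3 -> a = 0.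
Proof. by move=> -> -> -> ->; rewrite !mulr0 !addr0. Qed.

Lemma diff0 (x y : V) : x = y -> forall k, vphi k x - vphi k y = 0.
Proof. by move=> -> k; rewrite subrr. Qed.

Section Jordan.
Hypothesis J : forall x y, ((x ** x) ** y) ** x = (x ** x) ** (y ** x).

(* The coefficient of [t] in the Jordan identity for [x + t z], extracted from
   [t = 1], [t = - 1] and the coefficient of [t ^ 3]. *)
Lemma jordan_linearized x z y :
  2 *: (((x ** z) ** y) ** x) + ((x ** x) ** y) ** z =
  2 *: ((x ** z) ** (y ** x)) + (x ** x) ** (y ** z).
Proof.
apply/vphiP => k; apply/eqP; rewrite -subr_eq0; apply/eqP.
have H1 := diff0 (J (x + z) y) k; have H2 := diff0 (J (x - z) y) k.
have H3 := diff0 (J z y) k.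
apply: (linear_combination3 (k1 := 2^-1) (k2 := - 2^-1) (k3 := -1) H1 H2 H3).
rewrite !(linearDl, linearDr, linearNl, linearNr) (C z x).
by rewrite !vphiE; field.
Qed.

Lemma fourth_power_assoc_jordan b : fourth_power_assoc mu b.
Proof. by move=> x y z; rewrite J. Qed.

End Jordan.

Lemma square_in_plane_structure b (a1 a2 b1 b2 c1 c2 d1 d2 f1 f2 g1 g2 : F) :
  @basis3 F V b ->
  has_structure mu b (Structure (a1, a2, 0) (b1, b2, 0) (c1, c2, 0) (d1, d2, 0)
    (f1, f2, 0) (g1, g2, 0)) -> square_in_plane mu b.
Proof.
move=> B S x y; have [[[x1 x2] x3] ->] := B.2 x; have [[[y1 y2] y3] ->] := B.2 y.
rewrite (mul_lin _ _ C S); do 2!eexists; congr lin; coords.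
by congr (_, _, _); ring.
Qed.

Lemma monic_cubic_split (al be ga : F) : exists r1 r2 r3 : F,
  [/\ al = r1 * r2 * r3, be = - (r1 * r2 + r1 * r3 + r2 * r3) & ga = r1 + r2 + r3].
Proof.
have [r Er] := solve_monicpoly (n := 3) (fun i => [:: al; be; ga]`_i) isT.
rewrite !big_ord_recr big_ord0 /= add0r expr0 mulr1 expr1 in Er.
have [s [t [Es Et]]] := monic_quadratic_split (ga - r) (r ^+ 2 - ga * r - be).
exists r, s, t; split.
- by rewrite -mulrA -Et; transitivity (r ^+ 3 - ga * r ^+ 2 - be * r); [rewrite Er | ]; ring.
- have -> : r * s + r * t + s * t = r * (s + t) + s * t by ring.
  by rewrite -Es -Et; ring.
- by rewrite -addrA -Es; ring.
Qed.

(* The basis [1, x, x ^ 2] of [F[x] / ((x - r1) (x - r2) (x - r3))]. *)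
Definition monogenic_structure (r1 r2 r3 : F) : structure F :=
  let al := r1 * r2 * r3 in let be := - (r1 * r2 + r1 * r3 + r2 * r3) in
  let ga := r1 + r2 + r3 in
  Structure (1, 0, 0) (0, 1, 0) (0, 0, 1) (0, 0, 1) (al, be, ga)
    (al * ga, al + be * ga, be + ga ^+ 2).

Lemma in_list_monogenic_double b r s : @basis3 F V b ->
  has_structure mu b (monogenic_structure r r s) -> in_list mu.
Proof.
rewrite /monogenic_structure => B S.
have [rs|rs] := eqVneq (r - s) 0.
  have {}rs : s = r by apply/eqP; rewrite eq_sym -subr_eq0 rs.
  rewrite rs in S.
  change_basis (in_list_J C B S J10 (1, 0, 0) (- r, 1, 0) (r ^+ 2, - 2 * r, 1) 1).
have sr : s - r != 0 by rewrite -opprB oppr_eq0.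
(* Chinese remainders: the idempotent [(x - r)^2 / (s - r)^2], its complement, and the nilpotent
   [(x - r) (x - s)]. *)
change_basis (in_list_J C B S J08
  (r ^+ 2 / (s - r) ^+ 2, - 2 * r / (s - r) ^+ 2, (s - r) ^- 2)
  (1 - r ^+ 2 / (s - r) ^+ 2, 2 * r / (s - r) ^+ 2, - (s - r) ^- 2)
  (r * s, - (r + s), 1) (- ((s - r) ^- 2 * (s - r)))).
Qed.

Lemma in_list_monogenic b r1 r2 r3 : @basis3 F V b ->
  has_structure mu b (monogenic_structure r1 r2 r3) -> in_list mu.
Proof.
move=> B S.
have [r12|r12] := eqVneq (r1 - r2) 0.
  have {}r12 : r2 = r1 by apply/eqP; rewrite eq_sym -subr_eq0 r12.
  by rewrite r12 in S; apply: in_list_monogenic_double B S.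
have [r13|r13] := eqVneq (r1 - r3) 0.
  have {}r13 : r3 = r1 by apply/eqP; rewrite eq_sym -subr_eq0 r13.
  apply: (in_list_monogenic_double (r := r1) (s := r2) B).
  rewrite r13 in S; congr has_structure: S; rewrite /monogenic_structure.
  by congr Structure; congr (_, _, _); ring.
have [r23|r23] := eqVneq (r2 - r3) 0.
  have {}r23 : r3 = r2 by apply/eqP; rewrite eq_sym -subr_eq0 r23.
  apply: (in_list_monogenic_double (r := r2) (s := r1) B).
  rewrite r23 in S; congr has_structure: S; rewrite /monogenic_structure.
  by congr Structure; congr (_, _, _); ring.
have r21 : r2 - r1 != 0 by rewrite -opprB oppr_eq0.
have r31 : r3 - r1 != 0 by rewrite -opprB oppr_eq0.
have r32 : r3 - r2 != 0 by rewrite -opprB oppr_eq0.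
rewrite /monogenic_structure in S.
(* The Lagrange idempotents of three distinct roots. *)
change_basis (in_list_J C B S J07
  (r2 * r3 / ((r1 - r2) * (r1 - r3)), - (r2 + r3) / ((r1 - r2) * (r1 - r3)),
     ((r1 - r2) * (r1 - r3))^-1)
  (r1 * r3 / ((r2 - r1) * (r2 - r3)), - (r1 + r3) / ((r2 - r1) * (r2 - r3)),
     ((r2 - r1) * (r2 - r3))^-1)
  (r1 * r2 / ((r3 - r1) * (r3 - r2)), - (r1 + r2) / ((r3 - r1) * (r3 - r2)),
     ((r3 - r1) * (r3 - r2))^-1)
  (((r2 - r1) * (r3 - r1) * (r3 - r2))^-1)).
Qed.

Lemma in_list_quadratic b (k22 k23 k33 : F) : @basis3 F V b ->
  has_structure mu b (Structure (1, 0, 0) (0, 1, 0) (0, 0, 1)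
    (k22, 0, 0) (k23, 0, 0) (k33, 0, 0)) -> in_list mu.
Proof.
move=> B0 S0.
have [p [q [r [s [D E1 E2]]]]] := binary_form k22 k23 k33.
have [b2 B S] : exists2 b', basis3 b' & has_structure mu b' (Structure
   (1, 0, 0) (0, 1, 0) (0, 0, 1) (k22 * p ^+ 2 + 2 * k23 * p * q + k33 * q ^+ 2, 0, 0)
   (k22 * p * r + k23 * (p * s + q * r) + k33 * q * s, 0, 0)
   (k22 * r ^+ 2 + 2 * k23 * r * s + k33 * s ^+ 2, 0, 0)).
  change_basis (rebase (1, 0, 0) (0, p, q) (0, r, s) (p * s - q * r) C B0 S0).
case: E2 => [[E2 [E3|E3]]|[E2 E3]]; rewrite E1 E2 E3 in S.
- change_basis (in_list_J C B S J09 (1, 0, 0) (0, 1, 0) (0, 0, 1) 1).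
- change_basis (in_list_J C B S J17 (1/2, 0, 1/2) (1/2, 0, - 1/2) (0, 1, 0) (2^-1)).
(* For the last two basis vectors, [v^2 = w^2 = 0] and [v w = 1]. So [v + w / 2] has square [1] and
   yields two idempotents, while [v - w / 2] has square [- 1], corrected by the factor [i]. *)
- have [i Ei] := nth_root (-1 : F) (ltn0Sn 1).
  have i0 : i != 0.
    by apply/eqP => i0; move/eqP: Ei; rewrite i0 expr0n /= oppr_eq0 oner_eq0.
  apply: (in_list_J C B S J12 (1/2, 1/2, 1/4) (1/2, - 1/2, - 1/4)
    (0, i, - i / 2) (i / 2)); first by solve_neq0.
    by coords; field.
  table_simpl; rewrite /change_of_structure; coords.
  do 2!split; try by congr (_, _, _); field.
  congr (_, _, _); try by field.
  by transitivity (- i ^+ 2); [field | rewrite -Ei; field].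
Qed.

Lemma in_list_unital b (a1 a2 a3 b1 b2 b3 g1 g2 g3 : F) :
  (forall x, (x ** x) ** (x ** x) = ((x ** x) ** x) ** x) -> @basis3 F V b ->
  has_structure mu b (Structure (1, 0, 0) (0, 1, 0) (0, 0, 1)
    (a1, a2, a3) (b1, b2, b3) (g1, g2, g3)) -> in_list mu.
Proof.
move=> PA B S.
(* The alternative is applied modulo the unit: either [1, z, z^2] is a basis, or [z^2] is congruent
   to [f(z) z]. *)
have [[x [y D]]|[E1 [E2 [E3 E4]]]] := binary_algebra_alternative a2 a3 b2 b3 g2 g3.
  set m := (X in _ - _ * X) in D; set n := (X in x * X) in D.
  pose l := a1 * x ^+ 2 + 2 * b1 * x * y + g1 * y ^+ 2.
  set e := lin b (1, 0, 0); set z := lin b (0, x, y); set z2 := lin b (l, m, n).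
  have B' : @basis3 F V (e, z, z2) by apply: basis3_change B D _; coords; ring.
  have Ee : e ** e = e.
    by rewrite (mul_lin _ _ C S); congr lin; coords; congr (_, _, _); ring.
  have Ez : e ** z = z.
    by rewrite (mul_lin _ _ C S); congr lin; coords; congr (_, _, _); ring.
  have Ez2 : e ** z2 = z2.
    by rewrite (mul_lin _ _ C S); congr lin; coords; congr (_, _, _); ring.
  have Ezz : z ** z = z2.
    rewrite (mul_lin _ _ C S); congr lin; coords.
    by congr (_, _, _); rewrite ?/l ?/m ?/n; ring.
  clearbody e z z2.
  have [[[al be] ga] Ez3] := B'.2 (z ** z2).
  have Ez4 : z2 ** z2 = al *: z + be *: z2 + ga *: (al *: e + be *: z + ga *: z2).
    have := PA z; rewrite !Ezz (C z2 z) Ez3 => ->.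
    rewrite {1}/lin /co1 /co2 /co3 /= !(linearDl, linearZl_LR) /= Ez Ezz (C z2) Ez3.
    by rewrite /lin /co1 /co2 /co3.
  have [r1 [r2 [r3 [Er1 Er2 Er3]]]] := monic_cubic_split al be ga.
  apply: (in_list_monogenic (r1 := r1) (r2 := r2) (r3 := r3) B').
  rewrite /monogenic_structure -Er1 -Er2 -Er3.
  do 2!split; rewrite /= ?Ee ?Ez ?Ez2 ?Ezz ?Ez3 ?Ez4 //;
    by rewrite /lin /co1 /co2 /co3 /=; vring.
rewrite {a2}E1 {a3}E2 {g2}E3 {g3}E4 in S.
(* Subtracting [f / 2] times the unit from the other basis vectors makes their products scalar. *)
have [b' B' S'] : exists2 b', basis3 b' & has_structure mu b' (Structure (1, 0, 0)
    (0, 1, 0) (0, 0, 1) (a1 + b3 ^+ 2, 0, 0) (b1 + b2 * b3, 0, 0) (g1 + b2 ^+ 2, 0, 0)).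
  change_basis (rebase (1, 0, 0) (- b3, 1, 0) (- b2, 0, 1) 1 C B S).
exact: in_list_quadratic B' S'.
Qed.

End UnitalAlgebras.

(** * Peirce decomposition *)

Section Peirce.
Context {F : numClosedFieldType} {V : vectType F} (mu : {bilinear V -> V -> V}).
Hypothesis C : commutative_alg mu.
Local Notation "x ** y" := (mu x y) (at level 40, left associativity).
Hypothesis J : forall x y, ((x ** x) ** y) ** x = (x ** x) ** (y ** x).

Lemma mul0_of_unit (a x : F) : a != 0 -> a * x = 0 -> x = 0.
Proof. by move=> a0 /eqP; rewrite mulf_eq0 (negPf a0) => /eqP. Qed.

Section Idempotent.
Variable e : V.
Hypothesis ee : e ** e = e.

(** Linearising at [e] shows that multiplication by [e] is a root of [t (2 t - 1) (t - 1)]. *)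
Lemma peirce_polynomial z :
  2 *: (e ** (e ** (e ** z))) - 3 *: (e ** (e ** z)) + e ** z = 0.
Proof.
have := jordan_linearized C J e z e; rewrite !ee (C (e ** z) e) (C _ e) => E.
apply/vphiP => k; have := diff0 E k; rewrite !vphiE => D.
by rewrite -[RHS]D; ring.
Qed.

(** Multiplications by [e] and by a vector of Peirce value 0 or 1 commute, so the latter preserves
    the Peirce spaces. *)
Lemma peirce_mul i z y : e ** z = i *: z -> 1 - 2 * i != 0 -> e ** (z ** y) = z ** (e ** y).
Proof.
move=> ez i0; have := jordan_linearized C J e z y; rewrite !ee ez !linearZl_LR /=.
rewrite (C (z ** y) e) (C (e ** y) z) (C y e) (C y z) => E.
apply/vphiP => k; have := diff0 E k; rewrite !vphiE => D.
apply/eqP; rewrite -subr_eq0; apply/eqP; apply: (mul0_of_unit i0).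
by rewrite -[RHS]oppr0 -D; ring.
Qed.

(** Since 1/2 is not a root of [t^2 = t], squares of half vectors have no half component. *)
Lemma peirce_half_square z : e ** z = 2^-1 *: z ->
  e ** (e ** (z ** z)) = e ** (z ** z).
Proof.
move=> ez; have := jordan_linearized C J z e e.
rewrite (C z e) ez ee !(linearZl_LR, linearZr_LR) /= (C z e) ez.
rewrite !(linearZl_LR, linearZr_LR) /= (C (z ** z) e) (C (e ** (z ** z)) e) => E.
apply/vphiP => k; have := diff0 E k; rewrite /= !vphiE => D.
by apply/eqP; rewrite -subr_eq0 -[X in _ == X]D; apply/eqP; field.
Qed.

Lemma peirce_half_mul z y : e ** z = 2^-1 *: z -> e ** y = 2^-1 *: y ->
  e ** (e ** (z ** y)) = e ** (z ** y).
Proof.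
move=> ez ey.
have Ez := peirce_half_square ez; have Ey := peirce_half_square ey.
have : e ** (z + y) = 2^-1 *: (z + y) by rewrite linearDr ez ey scalerDr.
move/peirce_half_square; rewrite !(linearDl, linearDr) Ez Ey (C y z) => E.
apply/vphiP => k; have := diff0 E k; rewrite !vphiE => D.
apply/eqP; rewrite -subr_eq0 -(mulrI_eq0 _ (@mulfI F 2 _)) ?pnatr_eq0 //.
by rewrite -[X in _ == X]D; apply/eqP; ring.
Qed.

Definition peirce (z : V) :=
  [\/ e ** z = 0, e ** z = 2^-1 *: z | e ** z = z].

(** The projections are the Lagrange polynomials [1 - 3 t + 2 t^2], [4 t - 4 t^2], [2 t^2 - t] at 0,
    1/2, 1, evaluated at multiplication by [e]. *)
Lemma peirce_decomposition z :
  exists z0 zh z1, [/\ peirce z0, peirce zh, peirce z1 & z = z0 + zh + z1].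
Proof.
pose L1 := e ** z; pose L2 := e ** L1; pose L3 := e ** L2.
have H : 2 *: L3 - 3 *: L2 + L1 = 0 by apply: peirce_polynomial.
have H3 : L3 = (3 / 2) *: L2 - 2^-1 *: L1.
  apply/vphiP => k; have := congr1 (vphi k) H; rewrite !vphiE => D.
  apply/eqP; rewrite -subr_eq0 -(mulrI_eq0 _ (@mulfI F 2 _)) ?pnatr_eq0 //.
  by rewrite -D; apply/eqP; field.
exists (z - 3 *: L1 + 2 *: L2), (4 *: L1 - 4 *: L2), (2 *: L2 - L1); split.
- apply: Or31; rewrite !(linearDr, linearNr, linearZr_LR) /=.
  by rewrite -/L1 -/L2 -/L3 H3; vfield.
- apply: Or32; rewrite !(linearDr, linearNr, linearZr_LR) /=.
  by rewrite -/L1 -/L2 -/L3 H3; vfield.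
- apply: Or33; rewrite !(linearDr, linearNr, linearZr_LR) /=.
  by rewrite -/L1 -/L2 -/L3 H3; vfield.
- by vring.
Qed.

End Idempotent.

(** An exchange argument: the Peirce components of [u] have [u] coordinates of sum one, so one of
    them can replace [u]; then the same for [v]. *)
Lemma peirce_basis (b : V * V * V) e : e ** e = e -> e != 0 -> @basis3 F V b ->
  exists u v, [/\ @basis3 F V (e, u, v), peirce e u & peirce e v].
Proof.
move=> ee e0 B; have [u [v B1]] := basis3_extend1 B e0.
have [u0 [uh [u1 [P0 Ph P1 Eu]]]] := peirce_decomposition ee u.
have step2 w w' : co2 (w : vec F) != 0 -> w' = lin (e, u, v) w -> @basis3 F V (e, w', v).
  move=> w0 ->; have := basis3_change (p1 := (1, 0, 0)) (p2 := w) (p3 := (0, 0, 1)) B1 w0.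
  have -> : lin (e, u, v) (1, 0, 0) = e by rewrite /lin /co1 /co2 /co3 /=; vring.
  have -> : lin (e, u, v) (0, 0, 1) = v by rewrite /lin /co1 /co2 /co3 /=; vring.
  by apply; case: (w) => [[? ?] ?]; coords; ring.
have {Eu u0 uh u1 P0 Ph P1 step2} [u' B2 Pu] : exists2 u', @basis3 F V (e, u', v) & peirce e u'.
  have [p0 E0] := B1.2 u0; have [ph Eh] := B1.2 uh; have [p1 E1] := B1.2 u1.
  have : co2 p0 + co2 ph + co2 p1 = 1.
    have E : lin (e, u, v) (0, 1, 0) = lin (e, u, v)
      (co1 p0 + co1 ph + co1 p1, co2 p0 + co2 ph + co2 p1, co3 p0 + co3 ph + co3 p1).
      transitivity u; first by rewrite /lin /co1 /co2 /co3 /=; vring.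
      by rewrite {1}Eu E0 Eh E1 /lin /co1 /co2 /co3 /=; vring.
    by have [_ <- _] := lin_inj B1.1 E.
  have [Z0|/step2/(_ E0)] := eqVneq (co2 p0) 0; last by exists u0.
  have [Zh|/step2/(_ Eh)] := eqVneq (co2 ph) 0; last by exists uh.
  have [Z1|/step2/(_ E1)] := eqVneq (co2 p1) 0; last by exists u1.
  by rewrite Z0 Zh Z1 !addr0 => /esym/eqP; rewrite oner_eq0.
exists u'.
have [u0 [uh [u1 [P0 Ph P1 Eu]]]] := peirce_decomposition ee v.
have step3 w w' : co3 (w : vec F) != 0 -> w' = lin (e, u', v) w -> @basis3 F V (e, u', w').
  move=> w0 ->; have := basis3_change (p1 := (1, 0, 0)) (p2 := (0, 1, 0)) (p3 := w) B2 w0.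
  have -> : lin (e, u', v) (1, 0, 0) = e by rewrite /lin /co1 /co2 /co3 /=; vring.
  have -> : lin (e, u', v) (0, 1, 0) = u' by rewrite /lin /co1 /co2 /co3 /=; vring.
  by apply; case: (w) => [[? ?] ?]; coords; ring.
have [p0 E0] := B2.2 u0; have [ph Eh] := B2.2 uh; have [p1 E1] := B2.2 u1.
have : co3 p0 + co3 ph + co3 p1 = 1.
  have E : lin (e, u', v) (0, 0, 1) = lin (e, u', v)
      (co1 p0 + co1 ph + co1 p1, co2 p0 + co2 ph + co2 p1, co3 p0 + co3 ph + co3 p1).
    transitivity v; first by rewrite /lin /co1 /co2 /co3 /=; vring.
    by rewrite {1}Eu E0 Eh E1 /lin /co1 /co2 /co3 /=; vring.
  by have [_ _ <-] := lin_inj B2.1 E.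
have [Z0|/step3/(_ E0)] := eqVneq (co3 p0) 0; last by exists u0.
have [Zh|/step3/(_ Eh)] := eqVneq (co3 ph) 0; last by exists uh.
have [Z1|/step3/(_ E1)] := eqVneq (co3 p1) 0; last by exists u1.
by rewrite Z0 Zh Z1 !addr0 => /esym/eqP; rewrite oner_eq0.
Qed.

Lemma eigen_coords e u v (i j l : F) x1 x2 x3 : @basis3 F V (e, u, v) ->
  e ** e = e -> e ** u = i *: u -> e ** v = j *: v ->
  e ** lin (e, u, v) (x1, x2, x3) = l *: lin (e, u, v) (x1, x2, x3) ->
  [/\ (1 - l) * x1 = 0, (i - l) * x2 = 0 & (j - l) * x3 = 0].
Proof.
move=> B ee eu ev E.
suff [-> -> ->] : ((1 - l) * x1, (i - l) * x2, (j - l) * x3) = (0, 0, 0) by [].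
apply: B.1; move: E.
rewrite /lin /co1 /co2 /co3 /= !linearDr !linearZr_LR ee eu ev /= => E.
apply/vphiP => k; have := diff0 E k; rewrite !vphiE => D.
by rewrite -[RHS]D; ring.
Qed.

End Peirce.

(** * Jordan algebras with an idempotent, by Peirce type *)

Section PeirceCases.
Context {F : numClosedFieldType} {V : vectType F} (mu : {bilinear V -> V -> V}).
Hypothesis C : commutative_alg mu.
Hypothesis N : alg_nontrivial mu.
Local Notation "x ** y" := (mu x y) (at level 40, left associativity).
Hypothesis J : forall x y, ((x ** x) ** y) ** x = (x ** x) ** (y ** x).

Lemma fourth_power x : (x ** x) ** (x ** x) = ((x ** x) ** x) ** x.
Proof. exact/esym/J. Qed.

Lemma in_list_plane_structure b (a1 a2 b1 b2 c1 c2 d1 d2 f1 f2 g1 g2 : F) :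
  @basis3 F V b ->
  has_structure mu b (Structure (a1, a2, 0) (b1, b2, 0) (c1, c2, 0) (d1, d2, 0)
    (f1, f2, 0) (g1, g2, 0)) -> in_list mu.
Proof.
move=> B S; apply: (in_list_plane C N B).
  exact: (square_in_plane_structure C B S).
exact: fourth_power_assoc_jordan.
Qed.

(* The intermediate products are parameters, to be supplied in reduced form. *)
Lemma fourth_power_coords b s p q r : @basis3 F V b -> has_structure mu b s ->
  smul s p p = q -> smul s q p = r ->
  [/\ comb6 (@co1 F) s q q = comb6 (@co1 F) s r p,
      comb6 (@co2 F) s q q = comb6 (@co2 F) s r p
    & comb6 (@co3 F) s q q = comb6 (@co3 F) s r p].
Proof.
move=> B S Eq Er.
suff [] : smul s q q = smul s r p by [].
by apply: (lin_inj B.1); rewrite -Er -Eq -!(mul_lin _ _ C S) fourth_power.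
Qed.

Lemma jordan_linearized_coords b s p q r pq pp rp rq pqr ppr :
  @basis3 F V b -> has_structure mu b s ->
  smul s p q = pq -> smul s p p = pp -> smul s r p = rp -> smul s r q = rq ->
  smul s pq r = pqr -> smul s pp r = ppr ->
  let k1 := @co1 F in let k2 := @co2 F in let k3 := @co3 F in
  [/\ 2 * comb6 k1 s pqr p + comb6 k1 s ppr q = 2 * comb6 k1 s pq rp + comb6 k1 s pp rq,
      2 * comb6 k2 s pqr p + comb6 k2 s ppr q = 2 * comb6 k2 s pq rp + comb6 k2 s pp rq
    & 2 * comb6 k3 s pqr p + comb6 k3 s ppr q = 2 * comb6 k3 s pq rp + comb6 k3 s pp rq].
Proof.
move=> B S E1 E2 E3 E4 E5 E6 k1 k2 k3.
have K p1 p2 : 2 *: lin b p1 + lin b p2 =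
    lin b (2 * co1 p1 + co1 p2, 2 * co2 p1 + co2 p2, 2 * co3 p1 + co3 p2).
  by rewrite /lin /co1 /co2 /co3 /=; vring.
have := jordan_linearized C J (lin b p) (lin b q) (lin b r).
by rewrite !(mul_lin _ _ C S) E1 E2 E3 E4 E5 E6 !K => /(lin_inj B.1)[].
Qed.

Lemma sub0_eq (x y z : F) : x = y -> z = x - y -> z = 0.
Proof. by move=> -> ->; rewrite subrr. Qed.

Lemma half_sqr_eq0 (x : F) : x ^+ 2 / 2 = 0 -> x = 0.
Proof.
by move/eqP; rewrite mulf_eq0 invr_eq0 pnatr_eq0 orbF expf_eq0 => /eqP.
Qed.

Variables e u v : V.
Hypothesis B : @basis3 F V (e, u, v).
Hypothesis ee : e ** e = e.

Lemma lin1E : e = lin (e, u, v) (1, 0, 0).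
Proof. by rewrite /lin /co1 /co2 /co3 /=; vring. Qed.
Lemma lin2E (k : F) : k *: u = lin (e, u, v) (0, k, 0).
Proof. by rewrite /lin /co1 /co2 /co3 /=; vring. Qed.
Lemma lin3E (k : F) : k *: v = lin (e, u, v) (0, 0, k).
Proof. by rewrite /lin /co1 /co2 /co3 /=; vring. Qed.

Lemma structure_intro i j p q r : e ** u = i *: u -> e ** v = j *: v ->
  u ** u = lin (e, u, v) p -> u ** v = lin (e, u, v) q -> v ** v = lin (e, u, v) r ->
  has_structure mu (e, u, v) (Structure (1, 0, 0) (0, i, 0) (0, 0, j) p q r).
Proof.
move=> eu ev uu uv vv; do 2!split=> //=.
- by rewrite ee -lin1E.
- by rewrite eu lin2E.
- by rewrite ev lin3E.
Qed.

Lemma eq0_of_mulf (a x : F) : a * x = 0 -> a != 0 -> x = 0.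
Proof. by move=> E a0; apply: mul0_of_unit a0 E. Qed.

Lemma in_list_peirce_11 : e ** u = u -> e ** v = v -> in_list mu.
Proof.
move=> eu ev; have [[[a1 a2] a3] uu] := B.2 (u ** u).
have [[[b1 b2] b3] uv] := B.2 (u ** v); have [[[g1 g2] g3] vv] := B.2 (v ** v).
apply: (in_list_unital C fourth_power B); apply: structure_intro uu uv vv.
  by rewrite scale1r. by rewrite scale1r.
Qed.

Lemma half_shifts_neq0 : (1 - 2^-1 : F) != 0 /\ (2^-1 - 1 : F) != 0 /\ (2^-1 : F) != 0
  /\ (0 - 2^-1 : F) != 0 /\ (2^-1 - 0 : F) != 0.
Proof.
have -> : (1 - 2^-1 : F) = 2^-1 by field.
have -> : (2^-1 - 1 : F) = - 2^-1 by field.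
by rewrite sub0r subr0 !oppr_eq0 !invr_eq0 pnatr_eq0.
Qed.

Lemma in_list_peirce_hh : e ** u = 2^-1 *: u -> e ** v = 2^-1 *: v -> in_list mu.
Proof.
move=> eu ev; have [h1 [h2 [h3 [h4 h5]]]] := half_shifts_neq0.
have line z y : e ** z = 2^-1 *: z -> e ** y = 2^-1 *: y ->
    exists k, z ** y = lin (e, u, v) (k, 0, 0).
  move=> ez ey; have [[[x1 x2] x3] E] := B.2 (z ** y); exists x1; rewrite E.
  have E2 : e ** lin (e, u, v) (x1, x2, x3) = lin (e, u, v) (x1, 2^-1 * x2, 2^-1 * x3).
    by rewrite /lin /co1 /co2 /co3 /= !linearDr !linearZr_LR ee eu ev /=; vring.
  have := peirce_half_mul C J ee ez ey; rewrite E E2 -[RHS]scale1r => E3.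
  have [_] := eigen_coords B ee eu ev E3.
  by move=> /eq0_of_mulf/(_ h2)/(mul0_of_unit h3)-> /eq0_of_mulf/(_ h2)/(mul0_of_unit h3)->.
have [a uu] := line u u eu eu; have [k uv] := line u v eu ev.
have [g vv] := line v v ev ev.
have S := structure_intro eu ev uu uv vv.
(* If [z^2 = Q e], then [z^2 z^2 = Q^2 e] but [(z^2 z) z = (Q^2 / 2) e], so the form [Q]
   vanishes. *)
have sq (x y : F) : a * x ^+ 2 + 2 * k * x * y + g * y ^+ 2 = 0.
  set Q := (X in X = 0); apply: half_sqr_eq0.
  have [||E _ _] := fourth_power_coords (p := (0, x, y)) (q := (Q, 0, 0))
    (r := (0, Q * x / 2, Q * y / 2)) B S.
  - by coords; congr (_, _, _); rewrite /Q; ring.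
  - by coords; congr (_, _, _); field.
  by apply: (sub0_eq E); coords; rewrite /Q; field.
have a0 : a = 0 by rewrite -(sq 1 0); ring.
have g0 : g = 0 by rewrite -(sq 0 1); ring.
have k0 : k = 0.
  by apply: (@mul0_of_unit F 2); rewrite ?pnatr_eq0 // -(sq 1 1) a0 g0; ring.
rewrite a0 g0 k0 in S.
change_basis (in_list_J C B S J14 (1, 0, 0) (0, 1, 0) (0, 0, 1) 1).
Qed.

Lemma peirce_01_mul z y i j : e ** z = i *: z -> 1 - 2 * i != 0 -> e ** y = j *: y ->
  e ** (z ** y) = j *: (z ** y).
Proof. by move=> ez i0 ey; rewrite (peirce_mul C J ee y ez i0) ey linearZr_LR. Qed.

Lemma in_list_peirce_10 : e ** u = u -> e ** v = 0 -> in_list mu.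
Proof.
move=> eu0 ev0; have eu : e ** u = 1 *: u by rewrite scale1r.
have ev : e ** v = 0 *: v by rewrite scale0r.
have i1 : 1 - 2 * 1 != 0 :> F.
  have -> : 1 - 2 * 1 = -1 :> F by ring.
  by rewrite oppr_eq0 oner_eq0.
have i0 : 1 - 2 * 0 != 0 :> F by rewrite mulr0 subr0 oner_eq0.
have [[[a1 a2] a3] uu] := B.2 (u ** u).
have [[[b1 b2] b3] uv] := B.2 (u ** v); have [[[g1 g2] g3] vv] := B.2 (v ** v).
have := peirce_01_mul eu i1 eu; rewrite uu => /(eigen_coords B ee eu ev)[_ _].
rewrite sub0r => /eq0_of_mulf; rewrite oppr_eq0 oner_eq0 => /(_ isT) a30.
have := peirce_01_mul eu i1 ev; rewrite uv => /(eigen_coords B ee eu ev)[].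
rewrite subr0 !mul1r => b10 b20 _.
have := peirce_01_mul ev i0 eu; rewrite (C v) uv => /(eigen_coords B ee eu ev)[_ _].
rewrite sub0r => /eq0_of_mulf; rewrite oppr_eq0 oner_eq0 => /(_ isT) b30.
have := peirce_01_mul ev i0 ev; rewrite vv => /(eigen_coords B ee eu ev)[].
rewrite subr0 !mul1r => g10 g20 _.
rewrite a30 in uu; rewrite b10 b20 b30 in uv; rewrite g10 g20 in vv.
have S := structure_intro eu ev uu uv vv.
have [g0|g0] := eqVneq g3 0.
  by rewrite g0 in S; apply: in_list_plane_structure B S.
(* [v / g3] is an idempotent orthogonal to [e] and [u], so [e + v / g3] is a unit. *)
have [b' B' S'] : exists2 b', basis3 b' & has_structure mu b' (Structure (1, 0, 0)
    (0, 1, 0) (0, 0, 1) (a1, a2, - (a1 / g3)) (0, 0, 0) (0, 0, g3)).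
  change_basis (rebase (1, 0, g3^-1) (0, 1, 0) (0, 0, 1) 1 C B S).
exact: (in_list_unital C fourth_power B' S').
Qed.

Lemma in_list_J19 b (h1 h2 : F) : @basis3 F V b ->
  has_structure mu b (Structure (1, 0, 0) (0, 0, 0) (0, 0, 2^-1)
    (0, 1, 0) (0, 0, 0) (h1, h2, 0)) -> in_list mu.
Proof.
move=> B0 S.
have [h10 h20] : h1 = 0 /\ h2 = 0.
  have [||E1 E2 _] := fourth_power_coords (p := (0, 0, 1)) (q := (h1, h2, 0))
    (r := (0, 0, h1 / 2)) B0 S; do ?by coords; congr (_, _, _); field.
  have h10 : h1 = 0 by apply: half_sqr_eq0; apply: (sub0_eq E1); coords; field.
  split=> //; apply: half_sqr_eq0.
  suff -> : h2 ^+ 2 = 0 by rewrite mul0r.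
  by apply: (sub0_eq E2); coords; rewrite h10; field.
rewrite h10 h20 in S.
change_basis (in_list_J C B0 S J19 (1, 0, 0) (0, 1, 0) (0, 0, 1) 1).
Qed.

Lemma in_list_peirce_1h : e ** u = u -> e ** v = 2^-1 *: v -> in_list mu.
Proof.
move=> eu0 ev; have eu : e ** u = 1 *: u by rewrite scale1r.
have [h1 [h2 [h3 [h4 h5]]]] := half_shifts_neq0.
have i1 : 1 - 2 * 1 != 0 :> F.
  have -> : 1 - 2 * 1 = -1 :> F by ring.
  by rewrite oppr_eq0 oner_eq0.
have [[[a1 a2] a3] uu] := B.2 (u ** u).
have [[[b1 b2] b3] uv] := B.2 (u ** v); have [[[g1 g2] g3] vv] := B.2 (v ** v).
have := peirce_01_mul eu i1 eu; rewrite uu => /(eigen_coords B ee eu ev)[_ _].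
move=> /eq0_of_mulf/(_ h2) a30.
have := peirce_01_mul eu i1 ev; rewrite uv => /(eigen_coords B ee eu ev)[].
move=> /eq0_of_mulf/(_ h1) b10 /eq0_of_mulf/(_ h1) b20 _.
have E2 : e ** lin (e, u, v) (g1, g2, g3) = lin (e, u, v) (g1, g2, 2^-1 * g3).
  by rewrite /lin /co1 /co2 /co3 /= !linearDr !linearZr_LR ee eu ev /=; vring.
have := peirce_half_mul C J ee ev ev; rewrite vv E2 -[RHS]scale1r => E3.
have [_ _ /eq0_of_mulf/(_ h2)/(mul0_of_unit h3) g30] := eigen_coords B ee eu ev E3.
rewrite a30 in uu; rewrite b10 b20 in uv; rewrite g30 in vv.
have S := structure_intro eu ev uu uv vv.
pose c := b3 - a2 / 4.
have [b' B1 S1] : exists2 b', basis3 b' & has_structure mu b' (Structure (1, 0, 0)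
    (0, 1, 0) (0, 0, 2^-1) (a1 + a2 ^+ 2 / 4, 0, 0) (0, 0, c) (g1 + a2 / 2 * g2, g2, 0)).
  rewrite /c.
  change_basis (rebase (1, 0, 0) (- a2 / 2, 1, 0) (0, 0, 1) 1 C B S).
move: (a1 + _) c (g1 + _) S1 => k c g S1.
(* Now [u^2 = k e] and [u v = c v]; the linearised identity for [u], [v], [e] compares [u^2] with
   the square of this action. *)
have k4 : k = 4 * c ^+ 2.
  have [||||||_ _ E] := jordan_linearized_coords (p := (0, 1, 0)) (q := (0, 0, 1))
    (r := (1, 0, 0)) (pq := (0, 0, c)) (pp := (k, 0, 0)) (rp := (0, 1, 0))
    (rq := (0, 0, 2^-1)) (pqr := (0, 0, c / 2)) (ppr := (k, 0, 0)) B1 S1;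
    do ?by coords; congr (_, _, _); field.
  apply/eqP; rewrite -subr_eq0; apply/eqP; apply: (@mul0_of_unit F 4^-1).
    by rewrite ?invr_eq0 ?pnatr_eq0.
  by apply: (sub0_eq E); coords; field.
rewrite {k}k4 in S1.
have [c0|c0] := eqVneq c 0.
  rewrite c0 in S1.
  have g0 : g = 0.
    have [||E _ _] := fourth_power_coords (p := (0, 0, 1)) (q := (g, g2, 0))
      (r := (0, 0, g / 2)) B1 S1; do ?by coords; congr (_, _, _); field.
    by apply: half_sqr_eq0; apply: (sub0_eq E); coords; field.
  rewrite g0 in S1.
  have [g20|g20] := eqVneq g2 0.
    rewrite g20 in S1.
    change_basis (in_list_J C B1 S1 J13 (1, 0, 0) (0, 0, 1) (0, 1, 0) (- 1)).
  change_basis (in_list_J C B1 S1 J16 (1, 0, 0) (0, 0, 1) (0, g2, 0) (- g2)).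
(* [e / 2 + u / (4 c)] and [e / 2 - u / (4 c)] are orthogonal idempotents, acting on [v] by 1/2 and
   0. *)
have [b2' B2 S2] : exists2 b', basis3 b' & has_structure mu b' (Structure (1, 0, 0)
    (0, 0, 0) (0, 0, 2^-1) (0, 1, 0) (0, 0, 0) (g + 2 * c * g2, g - 2 * c * g2, 0)).
  change_basis (rebase (1/2, (4 * c)^-1, 0) (1/2, - (4 * c)^-1, 0) (0, 0, 1)
    (- (4 * c)^-1) C B1 S1).
exact: (in_list_J19 B2 S2).
Qed.

Lemma in_list_peirce_h0 : e ** u = 2^-1 *: u -> e ** v = 0 -> in_list mu.
Proof.
move=> eu ev0; have ev : e ** v = 0 *: v by rewrite scale0r.
have [h1 [h2 [h3 [h4 h5]]]] := half_shifts_neq0.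
have i0 : 1 - 2 * 0 != 0 :> F by rewrite mulr0 subr0 oner_eq0.
have [[[p1 p2] p3] uu] := B.2 (u ** u).
have [[[b1 b2] b3] uv] := B.2 (u ** v); have [[[g1 g2] g3] vv] := B.2 (v ** v).
have := peirce_01_mul ev i0 ev; rewrite vv => /(eigen_coords B ee eu ev)[].
rewrite !subr0 mul1r => g10 /(mul0_of_unit h3) g20 _.
have := peirce_01_mul ev i0 eu; rewrite (C v) uv => /(eigen_coords B ee eu ev)[].
move=> /eq0_of_mulf/(_ h1) b10 _ /eq0_of_mulf/(_ h4) b30.
have E2 : e ** lin (e, u, v) (p1, p2, p3) = lin (e, u, v) (p1, 2^-1 * p2, 0).
  by rewrite /lin /co1 /co2 /co3 /= !linearDr !linearZr_LR ee eu ev /=; vring.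
have := peirce_half_mul C J ee eu eu; rewrite uu E2 -[RHS]scale1r => E3.
have [_ /eq0_of_mulf/(_ h2)/(mul0_of_unit h3) p20 _] := eigen_coords B ee eu ev E3.
rewrite b10 b30 in uv; rewrite p20 in uu; rewrite g10 g20 in vv.
have S := structure_intro eu ev uu uv vv.
have [F1 F3] : p1 ^+ 2 = (p1 / 2 + p3 * b2) * p1 /\
    p3 ^+ 2 * g3 = (p1 / 2 + p3 * b2) * p3.
  have [||G1 _ G3] := fourth_power_coords (p := (0, 1, 0)) (q := (p1, 0, p3))
    (r := (0, p1 / 2 + p3 * b2, 0)) B S; do ?by coords; congr (_, _, _); field.
  by split; apply/eqP; rewrite -subr_eq0; apply/eqP;
    [apply: (sub0_eq G1) | apply: (sub0_eq G3)]; coords; field.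
have [g0|g0] := eqVneq g3 0.
  rewrite g0 in S F3.
  have [q0|q0] := eqVneq p3 0.
    rewrite q0 in S; apply: (in_list_plane_structure (b := (e, u, v)) B S).
  have K : p1 / 2 + p3 * b2 = 0.
    by apply: (mul0_of_unit q0); rewrite mulrC -F3 mulr0.
  have p10 : p1 = 0 by apply: half_sqr_eq0; rewrite F1 K !mul0r.
  have b20 : b2 = 0 by apply: (mul0_of_unit q0); rewrite -K p10 mul0r add0r.
  rewrite p10 b20 in S.
  change_basis (in_list_J C B S J15 (1, 0, 0) (0, 1, 0) (0, 0, p3) p3).
have [b' B1 S1] : exists2 b', basis3 b' & has_structure mu b' (Structure (1, 0, 0)
    (0, 2^-1, 0) (0, 0, 0) (p1, 0, p3 * g3) (0, b2 / g3, 0) (0, 0, 1)).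
  change_basis (rebase (1, 0, 0) (0, 1, 0) (0, 0, g3^-1) g3^-1 C B S).
have {}F1 : p1 ^+ 2 = (p1 / 2 + b2 / g3 * (p3 * g3)) * p1 by rewrite F1; field.
have {}F3 : (p3 * g3) ^+ 2 = (p1 / 2 + b2 / g3 * (p3 * g3)) * (p3 * g3).
  transitivity (p3 ^+ 2 * g3 * g3); first by ring.
  by rewrite F3; field.
move: (p3 * g3) (b2 / g3) F1 F3 S1 => q c F1 F3 S1.
(* Both [v] and [e + v] are idempotent and act on [u] by [c] and [1/2 + c]. Both values are roots of
   the Peirce polynomial, which leaves [c = 0] and [c = 1/2]; in the latter case [e + v] is a
   unit. *)
have poly : c * (2 * c - 1) * (c - 1) = 0.
  have [||||||_ E _] := jordan_linearized_coords (p := (0, 0, 1)) (q := (0, 1, 0))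
    (r := (0, 0, 1)) (pq := (0, c, 0)) (pp := (0, 0, 1)) (rp := (0, 0, 1))
    (rq := (0, c, 0)) (pqr := (0, c ^+ 2, 0)) (ppr := (0, 0, 1)) B1 S1;
    do ?by coords; congr (_, _, _); field.
  by apply: (sub0_eq E); coords; field.
have poly1 : (2^-1 + c) * (2 * (2^-1 + c) - 1) * (2^-1 + c - 1) = 0.
  set d := 2^-1 + c.
  have [||||||_ E _] := jordan_linearized_coords (p := (1, 0, 1)) (q := (0, 1, 0))
    (r := (1, 0, 1)) (pq := (0, d, 0)) (pp := (1, 0, 1)) (rp := (1, 0, 1))
    (rq := (0, d, 0)) (pqr := (0, d ^+ 2, 0)) (ppr := (1, 0, 1)) B1 S1;
    do ?by rewrite /d; coords; congr (_, _, _); field.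
  by apply: (sub0_eq E); rewrite /d; coords; field.
move/eqP: poly; rewrite !mulf_eq0 -orbA => /or3P[/eqP c0 | | ].
- have p0 : p1 = 0.
    by apply: half_sqr_eq0; rewrite -[RHS](subrr (p1 ^+ 2)) {3}F1 c0; field.
  have q0 : q = 0.
    by apply/eqP; rewrite -sqrf_eq0 F3 c0 p0 !mul0r addr0 mul0r.
  rewrite c0 p0 q0 in S1.
  change_basis (in_list_J C B1 S1 J19 (1, 0, 0) (0, 0, 1) (0, 1, 0) (- 1)).
- rewrite subr_eq0 => /eqP c2.
  have {c2} c2 : c = 2^-1 by apply: (@mulfI F 2); rewrite ?pnatr_eq0 // c2; field.
  rewrite c2 in S1.
  have [b2' B2 S2] : exists2 b', basis3 b' & has_structure mu b' (Structure (1, 0, 0)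
      (0, 1, 0) (0, 0, 1) (p1, 0, q - p1) (0, 2^-1, 0) (0, 0, 1)).
    change_basis (rebase (1, 0, 1) (0, 1, 0) (0, 0, 1) 1 C B1 S1).
  exact: (in_list_unital C fourth_power B2 S2).
- rewrite subr_eq0 => /eqP c1; move: poly1; rewrite c1.
  have -> : (2^-1 + 1) * (2 * (2^-1 + 1) - 1) * (2^-1 + 1 - 1) = 3 / 2 :> F by field.
  by move/eqP; rewrite mulf_eq0 invr_eq0 !pnatr_eq0.
Qed.

(* In [A_0(e)], an [x] with [x] and [x ^ 2] independent satisfies
   [x ^ 3 = (r + s) x ^ 2 - r s x]. *)
Lemma in_list_monogenic_00 b (r s : F) : @basis3 F V b ->
  has_structure mu b (Structure (1, 0, 0) (0, 0, 0) (0, 0, 0) (0, 0, 1)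
    (0, - (r * s), r + s) (0, - (r * s) * (r + s), (r + s) ^+ 2 - r * s)) ->
  in_list mu.
Proof.
move=> B0 S.
(* If a root is zero, the square lies in the plane of [e] and [x^2]. Otherwise
   [((r + s) x - x^2) / (r s)] is a unit of the null Peirce space, and adding [e] gives a unit of
   the algebra. *)
have [rs0|rs0] := eqVneq (r * s) 0.
  rewrite rs0 in S.
  have [b' B1 S1] : exists2 b', basis3 b' & has_structure mu b' (Structure (1, 0, 0)
      (0, 0, 0) (0, 0, 0) (0, (r + s) ^+ 2, 0) (0, r + s, 0) (0, 1, 0)).
    change_basis (rebase (1, 0, 0) (0, 0, 1) (0, 1, 0) (- 1) C B0 S).
  exact: (in_list_plane_structure B1 S1).
have [r0 s0] : r != 0 /\ s != 0 by apply/andP; rewrite mulf_eq0 negb_or in rs0.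
have [b' B1 S1] : exists2 b', basis3 b' & has_structure mu b' (Structure (1, 0, 0)
    (0, 1, 0) (0, 0, 1) (0, 0, 1)
    (0, - (r * s), r + s) (0, - (r * s) * (r + s), (r + s) ^+ 2 - r * s)).
  change_basis (rebase (1, (r + s) / (r * s), - (r * s)^-1) (0, 1, 0) (0, 0, 1) 1 C B0 S).
exact: (in_list_unital C fourth_power B1 S1).
Qed.

Lemma in_list_peirce_00 : e ** u = 0 -> e ** v = 0 -> in_list mu.
Proof.
move=> eu0 ev0; have ev : e ** v = 0 *: v by rewrite scale0r.
have eu : e ** u = 0 *: u by rewrite scale0r.
have i0 : 1 - 2 * 0 != 0 :> F by rewrite mulr0 subr0 oner_eq0.
have [[[a1 a2] a3] uu] := B.2 (u ** u).
have [[[b1 b2] b3] uv] := B.2 (u ** v); have [[[g1 g2] g3] vv] := B.2 (v ** v).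
have := peirce_01_mul eu i0 eu; rewrite uu => /(eigen_coords B ee eu ev)[].
rewrite !subr0 mul1r => a10 _ _.
have := peirce_01_mul eu i0 ev; rewrite uv => /(eigen_coords B ee eu ev)[].
rewrite !subr0 mul1r => b10 _ _.
have := peirce_01_mul ev i0 ev; rewrite vv => /(eigen_coords B ee eu ev)[].
rewrite !subr0 mul1r => g10 _ _.
rewrite a10 in uu; rewrite b10 in uv; rewrite g10 in vv.
have S := structure_intro eu ev uu uv vv.
have [[x [y D]]|[E1 [E2 [E3 E4]]]] := binary_algebra_alternative a2 a3 b2 b3 g2 g3.
  set m := (X in _ - _ * X) in D; set n := (X in x * X) in D.
  have Em : m = a2 * x ^+ 2 + 2 * b2 * x * y + g2 * y ^+ 2 by [].
  have En : n = a3 * x ^+ 2 + 2 * b3 * x * y + g3 * y ^+ 2 by [].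
  set z := lin (e, u, v) (0, x, y); set z2 := lin (e, u, v) (0, m, n).
  have B' : @basis3 F V (e, z, z2).
    by rewrite {1}lin1E; apply: basis3_change B D _; coords; ring.
  have Ez : e ** z = 0.
    by rewrite /z /lin /co1 /co2 /co3 /= !linearDr !linearZr_LR ee eu ev /=; vring.
  have Ez2 : e ** z2 = 0.
    by rewrite /z2 /lin /co1 /co2 /co3 /= !linearDr !linearZr_LR ee eu ev /=; vring.
  have Ezz : z ** z = z2.
    rewrite (mul_lin _ _ C S); congr lin; coords.
    by congr (_, _, _); rewrite ?Em ?En; ring.
  have Eez : e ** (z ** z2) = 0.
    rewrite (peirce_mul C J ee z2 (i := 0) _ i0); first by rewrite Ez2 linear0r.
    by rewrite Ez scale0r.
  clearbody z z2.
  have [[[al be] ga] Ez3] := B'.2 (z ** z2).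
  have al0 : al = 0.
    have E : e ** lin (e, z, z2) (al, be, ga) = 0 *: lin (e, z, z2) (al, be, ga).
      by rewrite scale0r -Ez3.
    have Ez0 : e ** z = 0 *: z by rewrite Ez scale0r.
    have Ez20 : e ** z2 = 0 *: z2 by rewrite Ez2 scale0r.
    by have [] := eigen_coords B' ee Ez0 Ez20 E; rewrite subr0 mul1r.
  rewrite al0 in Ez3.
  have Ez3' : z ** z2 = be *: z + ga *: z2.
    by rewrite Ez3 /lin /co1 /co2 /co3 /=; vring.
  have Ez4 : z2 ** z2 = be *: z2 + ga *: (be *: z + ga *: z2).
    have := fourth_power z; rewrite !Ezz (C z2 z) Ez3' => ->.
    by rewrite !(linearDl, linearZl_LR) /= Ezz (C z2) Ez3'.
  have [r [s [Er Es]]] := monic_quadratic_split ga (- be).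
  apply: (in_list_monogenic_00 (r := r) (s := s) B').
  rewrite -Er -Es !opprK.
  do 2!split; rewrite /= ?ee ?Ez ?Ez2 ?Ezz ?Ez3' ?Ez4 //;
    by rewrite /lin /co1 /co2 /co3 /=; vring.
rewrite E1 E2 E3 E4 in S.
(* On the null space [z^2 = f(z) z]. If [f] is nonzero, a vector with [f = 1] takes the role of
   [e_1], the given [e] that of [e_2], and the kernel of [f] supplies [e_3]. *)
have [b30|b30] := eqVneq b3 0; last first.
  have [b' B1 S1] : exists2 b', basis3 b' & has_structure mu b' (Structure (1, 0, 0)
    (0, 0, 0) (0, 0, 2^-1) (0, 1, 0) (0, 0, 0) (0, 0, 0)).
    change_basis (rebase (0, (2 * b3)^-1, 0) (1, 0, 0) (0, - b2 / b3, 1)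
      (- (2 * b3)^-1) C B S).
  exact: (in_list_J19 B1 S1).
have [b20|b20] := eqVneq b2 0; last first.
  rewrite b30 in S.
  have [b' B1 S1] : exists2 b', basis3 b' & has_structure mu b' (Structure (1, 0, 0)
    (0, 0, 0) (0, 0, 2^-1) (0, 1, 0) (0, 0, 0) (0, 0, 0)).
    change_basis (rebase (0, 0, (2 * b2)^-1) (1, 0, 0) (0, 1, 0)
      ((2 * b2)^-1) C B S).
  exact: (in_list_J19 B1 S1).
rewrite b20 b30 !mulr0 in S.
exact: (in_list_plane_structure B S).
Qed.

End PeirceCases.

(** * Finding an idempotent in a Jordan algebra *)

Section JordanAlgebras.
Context {F : numClosedFieldType} {V : vectType F} (mu : {bilinear V -> V -> V}).
Hypothesis C : commutative_alg mu.
Hypothesis N : alg_nontrivial mu.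
Local Notation "x ** y" := (mu x y) (at level 40, left associativity).
Hypothesis J : forall x y, ((x ** x) ** y) ** x = (x ** x) ** (y ** x).

Lemma in_list_idempotent (b : V * V * V) e : @basis3 F V b -> e ** e = e -> e != 0 -> in_list mu.
Proof.
move=> B0 ee e0; have [u [v [B Pu Pv]]] := peirce_basis C J ee e0 B0.
have B' : @basis3 F V (e, v, u).
  have := basis3_change (p1 := (1, 0, 0)) (p2 := (0, 0, 1)) (p3 := (0, 1, 0)) B
    (d := -1) _ _.
  rewrite -lin1E -lin2E -lin3E !scale1r; apply; last by coords; ring.
  by rewrite oppr_eq0 oner_eq0.
case: Pu Pv => eu [] ev.
- exact: (in_list_peirce_00 C N J B).
- exact: (in_list_peirce_h0 C N J B').
- exact: (in_list_peirce_10 C N J B').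
- exact: (in_list_peirce_h0 C N J B).
- exact: (in_list_peirce_hh C J B).
- exact: (in_list_peirce_1h C J B').
- exact: (in_list_peirce_10 C N J B).
- exact: (in_list_peirce_1h C J B).
- exact: (in_list_peirce_11 C J B).
Qed.

(** If [a] is nonzero, [(x^2 - b x) / a] is a unit for the powers of [x]; if [a = 0], [x^2 / b^2] is
    idempotent. *)
Lemma idempotent_of_cube (x : V) (a b : F) : ~ (exists k, x ** x = k *: x) ->
  (x ** x) ** x = a *: x + b *: (x ** x) -> (a != 0) || (b != 0) ->
  exists2 e, e ** e = e & e != 0.
Proof.
move=> NK E3 ab.
have E4 : (x ** x) ** (x ** x) = a *: (x ** x) + b *: (a *: x + b *: (x ** x)).
  by rewrite (fourth_power J) E3 linearDl !linearZl_LR /= E3.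
have [a0|a0] := eqVneq a 0.
  have b0 : b != 0 by rewrite a0 eqxx in ab.
  exists (b ^- 2 *: (x ** x)).
    by rewrite linearZl_LR linearZr_LR E4 a0; vfield; solve_neq0.
  apply/eqP => E; apply: NK; exists 0; rewrite scale0r.
  by move/eqP: E; rewrite scaler_eq0 invr_eq0 expf_eq0 /= (negPf b0) => /eqP.
exists (a^-1 *: (x ** x - b *: x)).
  rewrite !(linearZl_LR, linearZr_LR, linearDl, linearDr, linearNl, linearNr) /=.
  by rewrite E4 (C x (x ** x)) E3; vfield; solve_neq0.
apply/eqP => E; apply: NK; exists b.
by move/eqP: E; rewrite scaler_eq0 invr_eq0 (negPf a0) subr_eq0 => /eqP.
Qed.

Lemma indep2_square (x : V) : x != 0 -> ~ (exists k, x ** x = k *: x) -> @indep2 F V x (x ** x).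
Proof.
move=> x0 NK s t E; have [t0|t0] := eqVneq t 0.
  split=> //; move/eqP: E; rewrite t0 scale0r addr0 scaler_eq0 (negPf x0) orbF.
  by move/eqP.
case: NK; exists (- s / t).
have -> : x ** x = t^-1 *: (s *: x + t *: (x ** x)) - (s / t) *: x by vfield; solve_neq0.
by rewrite E; vring.
Qed.

(** If [x, x^2, x^3] are dependent and [x^3] is nonzero, their span contains an idempotent. If they
    are independent, they form a basis in which all products are powers of [x]. *)
Lemma cube_zero_or_in_list (b : V * V * V) x : @basis3 F V b -> (x ** x) ** x = 0 \/ in_list mu.
Proof.
move=> B0; have [->|x0] := eqVneq x 0; first by left; rewrite !linear0r.
have [[k Ek]|NK] := EM (exists k, x ** x = k *: x).
  have [k0|k0] := eqVneq k 0; first by left; rewrite Ek k0 scale0r linear0l.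
  right; apply: (in_list_idempotent (e := k^-1 *: x) B0).
    by rewrite linearZl_LR linearZr_LR Ek; vfield; solve_neq0.
  by rewrite scaler_eq0 invr_eq0 (negPf k0).
have [w B1] := basis3_extend2 B0 (indep2_square x0 NK).
have [[[m n] k] E3] := B1.2 ((x ** x) ** x).
have [k0|k0] := eqVneq k 0.
  have {}E3 : (x ** x) ** x = m *: x + n *: (x ** x).
    by rewrite E3 k0 /lin /co1 /co2 /co3 /=; vring.
  have [mn|] := boolP ((m != 0) || (n != 0)).
    by right; have [e ee e0] := idempotent_of_cube NK E3 mn; apply: in_list_idempotent B0 ee e0.
  by rewrite negb_or !negbK => /andP[/eqP m0 /eqP n0]; left; rewrite E3 m0 n0 !scale0r addr0.
right.
have B2 : @basis3 F V (x, x ** x, (x ** x) ** x).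
  have := basis3_change (p1 := (1, 0, 0)) (p2 := (0, 1, 0)) (p3 := (m, n, k)) B1 k0.
  rewrite -(lin1E x) -(lin2E x) scale1r -E3; apply.
  by coords; ring.
set z2 := x ** x in E3 B2 *; set z3 := z2 ** x in E3 B2 *.
have Exx : x ** x = z2 by [].
have E12 : x ** z2 = z3 by rewrite C.
have E22 : z2 ** z2 = z3 ** x by rewrite (fourth_power J).
have [[[al be] ga] E4] := B2.2 (x ** z3).
have E23 : z2 ** z3 = (z3 ** x) ** x.
  by have := J x z2; rewrite Exx E22 -/z3 => <-.
(* Linearised identity with both other arguments equal to [x^2]; the term [x^2 (x^2 x^2)]
   cancels. *)
have E33 : z3 ** z3 = (z2 ** z3) ** x.
  have := jordan_linearized C J x z2 z2; rewrite Exx E12 -/z3 => E.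
  apply: (scalerI (a := 2)); first by rewrite pnatr_eq0.
  move: E; rewrite (C z3 z2) (C (z2 ** z2) z2) => E.
  by apply: (addIr (z2 ** (z2 ** z2))); rewrite E.
have xl p : x ** lin (x, z2, z3) p =
    co1 p *: z2 + co2 p *: z3 + co3 p *: lin (x, z2, z3) (al, be, ga).
  by rewrite /lin !linearDr !linearZr_LR /= Exx E12 E4.
have S : has_structure mu (x, z2, z3) (Structure (0, 1, 0) (0, 0, 1) (al, be, ga)
    (al, be, ga) (ga * al, al + ga * be, be + ga ^+ 2)
    ((be + ga ^+ 2) * al, ga * al + (be + ga ^+ 2) * be, al + ga * be + (be + ga ^+ 2) * ga)).
  have E5 : z2 ** z3 = lin (x, z2, z3) (ga * al, al + ga * be, be + ga ^+ 2).
    rewrite E23 (C _ x) (C z3 x) E4 xl /lin /co1 /co2 /co3 /=; vring.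
  do 2!split => //=.
  - by rewrite Exx /lin /co1 /co2 /co3 /=; vring.
  - by rewrite E12 /lin /co1 /co2 /co3 /=; vring.
  - by rewrite E22 C.
  - by rewrite E33 E5 (C _ x) xl /lin /co1 /co2 /co3 /=; vring.
(* If [al = 0], the square lies in the plane of [x^2] and [x^3]; otherwise
   [(x^3 - ga x^2 - be x) / al] is a unit. *)
have [al0|al0] := eqVneq al 0.
  rewrite al0 in S.
  have [b' B' S'] : exists2 b', basis3 b' & has_structure mu b' (Structure
     (be, ga, 0) (ga * be, be + ga ^+ 2, 0) (0, 1, 0)
    ((be + ga ^+ 2) * be, ga * be + (be + ga ^+ 2) * ga, 0) (be, ga, 0) (1, 0, 0)).
    change_basis (rebase (0, 1, 0) (0, 0, 1) (1, 0, 0) 1 C B2 S).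
  exact: (in_list_plane_structure C N J B' S').
apply: (in_list_idempotent (e := lin (x, z2, z3) (- be / al, - ga / al, al^-1)) B0).
  by rewrite (mul_lin _ _ C S); congr lin; coords; congr (_, _, _); field; solve_neq0.
apply/eqP => /B2.1[_ _ /eqP].
by rewrite invr_eq0 (negPf al0).
Qed.

(** Take [x] with nonzero square and complete [x, x^2] by [w]. Nilpotency kills the [w] coordinate
    of every product, so the square lies in a plane. *)
Lemma in_list_nil (b : V * V * V) : @basis3 F V b -> (forall x, (x ** x) ** x = 0) -> in_list mu.
Proof.
move=> B0 nil3.
have [sq0|] := EM (forall x, x ** x = 0).
  case: N => x [y]; case/eqP.
  have := sq0 (x + y); rewrite linearDl !linearDr !sq0 (C y x) add0r addr0 => E.
  apply: (scalerI (a := (2 : F))); first by rewrite pnatr_eq0.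
  by rewrite scaler0 -E; vring.
move/existsNP => [x /eqP x20].
have x0 : x != 0 by apply: contra_neq x20 => ->; rewrite linear0r.
have NK : ~ (exists k, x ** x = k *: x).
  move=> [k Ek]; have := nil3 x; rewrite Ek linearZl_LR /= Ek => /eqP.
  rewrite !scaler_eq0 (negPf x0) orbF orbb => /eqP k0.
  by case/eqP: x20; rewrite Ek k0 scale0r.
have [w B] := basis3_extend2 B0 (indep2_square x0 NK).
have xx2 : x ** (x ** x) = 0 by rewrite C nil3.
have x2x2 : (x ** x) ** (x ** x) = 0 by rewrite (fourth_power J) nil3 linear0l.
have [[[a b'] c] xw] := B.2 (x ** w); have [[[d f] g] ww] := B.2 (w ** w).
(* The part of [(x + y)^3 = 0] linear in [y]. *)
have pol y : (x ** x) ** y = - 2 *: (x ** (x ** y)).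
  have P := diff0 (nil3 (x + y)); have M := diff0 (nil3 (x - y)); have Y := diff0 (nil3 y).
  apply/vphiP => k; apply/eqP; rewrite -subr_eq0; apply/eqP.
  apply: (linear_combination3 (k1 := 2^-1) (k2 := - 2^-1) (k3 := -1) (P k) (M k) (Y k)).
  rewrite !(linearDl, linearDr, linearNl, linearNr) (C y x) (C (x ** y) x) nil3.
  by rewrite !vphiE; field.
(* The linearised identity yields [8 x (x (x w)) = 0], and the [w] coordinate of [x (x (x w))] is
   [c^3]. *)
have c0 : c = 0.
  have E := jordan_linearized C J x w x; rewrite !nil3 linear0l addr0 in E.
  rewrite (C (x ** w) x) (C (x ** (x ** w)) x) (C (x ** w) (x ** x)) pol in E.
  have K : x ** (x ** (x ** w)) = 0.
    apply: (scalerI (a := (8 : F))); first by rewrite pnatr_eq0.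
    by rewrite scaler0; apply/vphiP => k; have := diff0 E k; rewrite !vphiE => <-; ring.
  move: K; rewrite xw /lin /co1 /co2 /co3 /= !linearDr !linearZr_LR /= xx2 xw.
  rewrite /lin /co1 /co2 /co3 /= !linearDr !linearZr_LR /= xx2 xw => K.
  have : lin (x, x ** x, w) (c ^+ 2 * a, c * a + c ^+ 2 * b', c ^+ 3) = 0.
    by rewrite -K /lin /co1 /co2 /co3 /=; vring.
  by move/B.1 => [_ _ /eqP]; rewrite expf_eq0 => /eqP.
rewrite c0 in xw.
have x2w : (x ** x) ** w = lin (x, x ** x, w) (0, - 2 * a, 0).
  rewrite pol xw /lin /co1 /co2 /co3 /= !linearDr !linearZr_LR /= xx2 xw.
  by rewrite /lin /co1 /co2 /co3 /=; vring.
have g0 : g = 0.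
  have := nil3 w; rewrite ww {1}/lin /co1 /co2 /co3 /= !linearDl !linearZl_LR /= xw x2w ww => K.
  have : lin (x, x ** x, w) (d * a + g * d, d * b' - f * (2 * a) + g * f, g ^+ 2) = 0.
    by rewrite -K /lin /co1 /co2 /co3 /=; vring.
  by move/B.1 => [_ _ /eqP]; rewrite expf_eq0 => /eqP.
rewrite g0 in ww.
have S : has_structure mu (x, x ** x, w) (Structure (0, 1, 0) (0, 0, 0) (a, b', 0)
    (0, 0, 0) (0, - 2 * a, 0) (d, f, 0)).
  do 2!split => //=.
  - by rewrite /lin /co1 /co2 /co3 /=; vring.
  - by rewrite xx2 /lin /co1 /co2 /co3 /=; vring.
  - by rewrite x2x2 /lin /co1 /co2 /co3 /=; vring.
exact: (in_list_plane_structure C N J B S).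
Qed.

Lemma in_list_jordan (b : V * V * V) : @basis3 F V b -> in_list mu.
Proof.
move=> B; have [/(in_list_nil B)//|] := EM (forall x, (x ** x) ** x = 0).
by move/existsNP => [x NE]; have [] := cube_zero_or_in_list x B.
Qed.

End JordanAlgebras.

(** * Isomorphisms between the exceptional algebras *)

Section NonIsomorphism.
Context {F : numClosedFieldType}.

(* The common shape of the last family, whose square is the plane algebra
   [e1 e1 = e1], [e1 e2 = e2 / 2]. *)
Definition half_structure (c d p q : F) : structure F :=
  Structure (1, 0, 0) (0, 2^-1, 0) (0, 0, 0) (0, 0, 0) (c, d, 0) (p, q, 0).

Definition DJ_params (l : DJ_label F) : F * F * F * F :=
  match l with
  | DJ01 a => (1, 0, 1, a)
  | DJ02 => (1, 0, 0, 1)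
  | DJ03 => (1, 0, 0, 0)
  | DJ04 a => (0, 1, a, 0)
  | DJ05 => (0, 1, - 4, 1)
  | DJ06 => (0, 0, 1, 0)
  | DJ07 => (0, 0, 0, 1)
  end.

Lemma DJ_structure l : structure_of (DJ_table l) =
  let: (c, d, p, q) := DJ_params l in half_structure c d p q.
Proof.
by case: l => *; table_simpl; congr Structure; congr (_, _, _); ring.
Qed.

(** The new basis consists of the images of [e1, e2, e3]; injectivity expresses their
    independence. *)
Lemma alg_iso_change (t t' : mult_table F) : alg_iso (table_alg t) (table_alg t') ->
  exists p1 p2 p3, (forall r, comb3 p1 p2 p3 r = (0, 0, 0) -> r = (0, 0, 0)) /\
    change_of_structure (structure_of t') p1 p2 p3 (structure_of t).
Proof.
move=> [f [[g fK _] fM]].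
pose p x := vec_of_row (f x).
have fE r : f (row3 r) = row3 (comb3 (p e1) (p e2) (p e3) r).
  by rewrite /row3 -lin_comb -!/(row3 _) !row3K /lin !linearD !linearZ.
have M x y : smul (structure_of t') (p x) (p y) = p (table_mul t x y).
  apply: (lin_inj basis3_std.1).
  rewrite -(mul_lin _ _ (@table_comm F t') (table_has_structure t')).
  by rewrite -!/(row3 _) !row3K fM.
exists (p e1), (p e2), (p e3); split=> [r E|].
  apply: (lin_inj basis3_std.1); apply: (can_inj fK).
  by rewrite -!/(row3 _) !fE E; congr row3; rewrite /comb3 !mul0r !addr0.
have pE x : p x = comb3 (p e1) (p e2) (p e3) (vec_of_row x).
  by rewrite -[in LHS](row3K x) {1}/p fE vec_of_rowK.
by do 2!split; rewrite M pE.
Qed.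

(** [e_1] and [e_2 = 2 e_1 e_2] are products, so their images stay in the plane, whose nonzero
    idempotents are [e_1 + t e_2]. Hence [e_1], [e_2], [e_3] go to [e_1 + t e_2], [s e_2],
    [m e_1 + n e_2 + l e_3]. *)
Lemma half_change c d p q c' d' p' q' p1 p2 p3 :
  (forall r, comb3 p1 p2 p3 r = (0, 0, 0) -> r = (0, 0, 0)) ->
  change_of_structure (half_structure c' d' p' q') p1 p2 p3 (half_structure c d p q) ->
  exists t s l m n, [/\ s != 0, l != 0, m = - (l * t * c') & n = - (t * m) - 2 * l * t * d'] /\
   [/\ c = s * l * c', s * m / 2 + s * l * d' = c * t + d * s,
       p = m ^+ 2 + 2 * l * n * c' + l ^+ 2 * p' &
       p * t + q * s = m * n + 2 * l * n * d' + l ^+ 2 * q'].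
Proof.
move: p1 p2 p3 => [[x t] z] [[w s] z'] [[m n] l] I.
rewrite /change_of_structure /half_structure; coords.
move=> [[[E1 E2 E3] [E4 E5 E6] [E7 E8 _]] [_ [E9 E10 _] [E11 E12 _]]].
have S (k a b y : F) : a = b -> y = k * (a - b) -> y = 0.
  by move=> -> ->; rewrite subrr mulr0.
have Q (a b : F) : a - b = 0 -> a = b by move/eqP; rewrite subr_eq0 => /eqP.
have z0 : z = 0 by apply: (S (-1) _ _ _ E3); ring.
have z0' : z' = 0 by apply: (S (- 2) _ _ _ E6); field.
subst z z'.
have x1 : x = 1.
  have /eqP : x * (x - 1) = 0 by apply: (S 1 _ _ _ E1); ring.
  rewrite mulf_eq0 subr_eq0 => /orP[/eqP x0|/eqP//].
  have t0 : t = 0 by apply: (S (-1) _ _ _ E2); rewrite x0; ring.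
  suff /I[/eqP] : comb3 (x, t, 0) (w, s, 0) (m, n, l) (1, 0, 0) = (0, 0, 0).
    by rewrite oner_eq0.
  by rewrite x0 t0; coords; congr (_, _, _); ring.
subst x.
have w0 : w = 0 by apply: (S 2 _ _ _ E4); field.
subst w.
have s0 : s != 0.
  apply/eqP => s0.
  suff /I[/eqP] : comb3 (1, t, 0) (0, s, 0) (m, n, l) (0, 1, 0) = (0, 0, 0).
    by rewrite oner_eq0.
  by rewrite s0; coords; congr (_, _, _); ring.
have l0 : l != 0.
  apply/eqP => l0.
  suff /I[_ _ /eqP] : comb3 (1, t, 0) (0, s, 0) (m, n, l) (- m, (m * t - n) / s, 1)
      = (0, 0, 0) by rewrite oner_eq0.
  by rewrite l0; coords; congr (_, _, _); field; solve_neq0.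
exists t, s, l, m, n; split; split=> //; apply: Q.
- by apply: (S 1 _ _ _ E7); ring.
- by apply: (S 2 _ _ _ E8); field.
- by apply: (S (-1) _ _ _ E9); ring.
- by apply: (S 1 _ _ _ E10); field.
- by apply: (S (-1) _ _ _ E11); ring.
- by apply: (S (-1) _ _ _ E12); field.
Qed.

Lemma scaled_sub0 (k x y z : F) : x = y -> z = k * (x - y) -> z = 0.
Proof. by move=> -> ->; rewrite subrr mulr0. Qed.

Lemma mulf_eq0_iff (k x y : F) : k != 0 -> x = k * y -> (x == 0) = (y == 0).
Proof. by move=> k0 ->; rewrite mulf_eq0 (negPf k0). Qed.

(** [c], and [d] once [c = 0], change by nonzero factors. If [c = c' = 1] and [d = d' = 0], then
    [t = 0] and only scalings remain; if [c = c' = 0] and [d = d' = 1], [e_3] is not scaled and [q]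
    moves by [(4 + p) t]. *)
Lemma DJ_iso_invariants (l l' : DJ_label F) :
  alg_iso (table_alg (DJ_table l)) (table_alg (DJ_table l')) ->
  let: (c, d, p, q) := DJ_params l in let: (c', d', p', q') := DJ_params l' in
  [/\ (c == 0) = (c' == 0),
      c = 0 -> c' = 0 -> (d == 0) = (d' == 0),
      c = 1 -> c' = 1 -> d = 0 -> d' = 0 ->
        exists k, [/\ k != 0, p = k ^+ 2 * p' & q = k ^+ 3 * q'],
      c = 0 -> c' = 0 -> d = 1 -> d' = 1 -> p = p' /\
        exists s t, s != 0 /\ q * s = q' - (4 + p) * t
    & c = 0 -> c' = 0 -> d = 0 -> d' = 0 -> exists2 k, k != 0 & p = k * p'].
Proof.
move=> /alg_iso_change[p1 [p2 [p3 [I]]]]; rewrite !DJ_structure.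
case: (DJ_params l) => [[[c d] p] q]; case: (DJ_params l') => [[[c' d'] p'] q'].
move=> /(half_change I)[t [s [k [m [n [[s0 k0 Em En] [E1 E2 E3 E4]]]]]]].
have sk0 : s * k != 0 by rewrite mulf_neq0.
split.
- exact: mulf_eq0_iff E1.
- move=> c0 c0'; apply: (mulf_eq0_iff k0); apply: (mulIf s0).
  by rewrite c0 mul0r add0r in E2; rewrite -E2 Em c0'; field.
- move=> c1 c1' d0 d0'.
  have sk : s * k = 1 by rewrite -[RHS]c1 E1 c1' mulr1.
  have t0 : t = 0.
    apply: (@mul0_of_unit F (3 / 2)); first by solve_neq0.
    transitivity (t + s * k * t / 2); first by rewrite sk; field.
    move: E2; rewrite c1 d0 d0' Em c1' => E2.
    by apply: (scaled_sub0 (k := -1) E2); field.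
  have m0 : m = 0 by rewrite Em t0; ring.
  have n0 : n = 0 by rewrite En t0; ring.
  have Es : s = k^-1 by apply: (mulIf k0); rewrite sk mulVf.
  exists k; split=> //; first by rewrite E3 m0 n0; ring.
  apply: (mulIf s0); move: E4; rewrite t0 m0 n0 Es mulr0 add0r => ->; field; solve_neq0.
- move=> c0 c0' d1 d1'.
  have m0 : m = 0 by rewrite Em c0'; ring.
  have Ek : k = 1.
    by apply: (mulfI s0); move: E2; rewrite c0 d1 d1' m0 mulr0 !mul0r !add0r mul1r !mulr1.
  have En' : n = - 2 * t by rewrite En m0 d1' Ek; ring.
  have Ep : p = p' by rewrite E3 m0 c0' Ek; ring.
  split=> //; exists s, t; split=> //.
  by apply/eqP; rewrite -subr_eq0; apply/eqP; apply: (scaled_sub0 (k := 1) E4);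
    rewrite m0 Ek En' d1'; ring.
- move=> c0 c0' d0 d0'; exists (k ^+ 2); first by solve_neq0.
  by rewrite E3 Em c0'; ring.
Qed.

Lemma DJ_iso (l l' : DJ_label F) :
  alg_iso (table_alg (DJ_table l)) (table_alg (DJ_table l')) <->
  (l = l' \/ exists a : F, l = DJ01 a /\ l' = DJ01 (- a)).
Proof.
split=> [/DJ_iso_invariants|].
  have n10 : (1 == 0 :> F) = false by rewrite oner_eq0.
  case: l l' => [a||| a|||] [a'||| a'|||] /= [];
    rewrite ?eqxx ?n10 // => _ G2 G3 G4 G5; try by left.
  all: try by have := G2 erefl erefl; rewrite ?eqxx ?n10.
  all: try have [k [k0 Ep Eq]] := G3 erefl erefl erefl erefl.
  all: try by move/eqP: Ep; rewrite ?mulr0 ?mulr1 ?n10 // eq_sym expf_eq0 (negPf k0) andbF.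
  all: try by move/eqP: Eq; rewrite ?mulr0 ?mulr1 ?n10 // eq_sym expf_eq0 (negPf k0) andbF.
  all: try have [k k0 E] := G5 erefl erefl erefl erefl.
  all: try by move/eqP: E; rewrite ?mulr0 ?mulr1 ?n10 // eq_sym (negPf k0).
  all: try have [E [s [t [s0 Es]]]] := G4 erefl erefl erefl erefl.
  (* Here [p = p' = 1], so [k] is 1 or -1, and [q = k^3 q'] gives the sign ambiguity. *)
  - have /eqP : k ^+ 2 = 1 by rewrite -[k ^+ 2]mulr1 -Ep.
    rewrite sqrf_eq1 => /orP[] /eqP k1; [left | right; exists a; split=> //].
      by rewrite Eq k1 expr1n mul1r.
    by congr DJ01; rewrite Eq k1; ring.
  - by left; rewrite E.
  (* [DJ04 (- 4)] and [DJ05] differ: as [4 + p = 0], [q] is only rescaled, so 0 and 1 are not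
     exchanged. *)
  - move/eqP: Es; rewrite E subrr !mul0r subr0 eq_sym n10 //.
  - move/eqP: Es; rewrite subrr mul0r subr0 mul1r (negPf s0) //.
case=> [-> | [a [-> ->]]].
  by exists (idfun : {linear _ -> _}); split=> //; exists idfun.
have S := table_has_structure (DJ_table (DJ01 a)).
rewrite DJ_structure in S.
apply: (table_alg_iso (@table_comm F _) basis3_std S
  (p1 := (1, 0, 0)) (p2 := (0, -1, 0)) (p3 := (0, 0, -1)) (oner_neq0 F)).
  by coords; ring.
by rewrite DJ_structure /half_structure /=; check_change.
Qed.
End NonIsomorphism.

(** * Derived Jordan algebras by the size of the square *)

Section Main.
Context {F : numClosedFieldType} {V : vectType F} (mu : {bilinear V -> V -> V}).
Local Notation "x ** y" := (mu x y) (at level 40, left associativity).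

Lemma dim3_basis : \dim {:V} = 3%N -> exists b, @basis3 F V b.
Proof.
have: basis_of {:V} (vbasis {:V}) := vbasisP _.
move: (vbasis _); move: (\dim {:V}) => n X XB n3; subst n.
exists (X`_0, X`_1, X`_2); split=> [[[x y] z]|v].
  move=> E; have /freeP := basis_free XB; move/(_ (fun i => [:: x; y; z]`_i)).
  rewrite !big_ord_recl big_ord0 addr0 addrA => /(_ E) K.
  by congr (_, _, _); [exact: (K 0) | exact: (K 1) | exact: (K 2)].
exists (coord X 0 v, coord X 1 v, coord X 2 v).
rewrite {1}(coord_basis XB (memvf v)) !big_ord_recl big_ord0 addr0 addrA.
by rewrite /lin /co1 /co2 /co3 /=; congr (_ + _ + _);
  congr (coord X _ v *: _); apply: val_inj.
Qed.

Lemma alg_square_comb (a b c : F) x1 y1 x2 y2 x3 y3 :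
  alg_square mu (a *: (x1 ** y1) + b *: (x2 ** y2) + c *: (x3 ** y3)).
Proof.
exists 3, (fun i => [:: a; b; c]`_i), (fun i => [:: x1; x2; x3]`_i),
  (fun i => [:: y1; y2; y3]`_i).
by rewrite !big_ord_recl big_ord0 addr0 addrA.
Qed.

Lemma derived_jordan_in_list : \dim {:V} = 3%N -> alg_nontrivial mu ->
  derived_jordan mu -> in_list mu.
Proof.
move=> /dim3_basis[b0 B0] N [C0 [_ J]].
have C : commutative_alg mu by move=> x y; apply: C0.
have [[u Lu]|NL] := EM (exists u, forall x y, exists k, x ** y = k *: u).
  exact: (in_list_line C B0 N Lu).
have [x0 [y0 u0]] := N; set u := x0 ** y0 in u0.
have [x1 [y1 Nv]] : exists x y, ~ exists k, x ** y = k *: u.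
  apply: contrapT => H; apply: NL; exists u => x y; apply: contrapT => H'.
  by apply: H; exists x, y.
set v := x1 ** y1 in Nv.
have I2 : @indep2 F V u v.
  move=> s t E; have [t0|t0] := eqVneq t 0.
    split=> //; move/eqP: E; rewrite t0 scale0r addr0 scaler_eq0 (negPf u0) orbF.
    by move/eqP.
  case: Nv; exists (- s / t).
  have -> : v = t^-1 *: (s *: u + t *: v) - (s / t) *: u by vfield; solve_neq0.
  by rewrite E; vring.
have [w B] := basis3_extend2 B0 I2.
have [Q|NQ] := EM (square_in_plane mu (u, v, w)).
  (* [u] and [v] are products, so the plane lies in the square, where the Jordan identity holds. *)
  apply: (in_list_plane C N B Q) => x y z.
  have z_sq : alg_square mu z.
    have -> : z = x *: u + y *: v + 0 *: u by rewrite /z /lin /co1 /co2 /co3 /=; vring.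
    exact: alg_square_comb.
  exact/esym/J.
have [x2 [y2 Nw]] : exists x y, ~ exists m n, x ** y = lin (u, v, w) (m, n, 0).
  apply: contrapT => H; apply: NQ => x y; apply: contrapT => H'.
  by apply: H; exists x, y.
set w' := x2 ** y2 in Nw.
have [[[m n] k] Ew] := B.2 w'.
have k0 : k != 0 by apply/eqP => k0; apply: Nw; exists m, n; rewrite Ew k0.
have B' : @basis3 F V (u, v, w').
  have := basis3_change (p1 := (1, 0, 0)) (p2 := (0, 1, 0)) (p3 := (m, n, k)) B k0.
  rewrite -lin1E -lin2E !scale1r -Ew; apply.
  by coords; ring.
(* Three independent products span [V], so the whole algebra is Jordan. *)
have sq z : alg_square mu z.
  by have [p ->] := B'.2 z; rewrite /lin; apply: alg_square_comb.
apply: (in_list_jordan C N _ B') => x y.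
exact: J.
Qed.
End Main.

Theorem theoremA3 (R : realType) :
  (forall (V : vectType R[i]) (mu : {bilinear V -> V -> V}),
     \dim {:V} = 3%N -> alg_nontrivial mu -> derived_jordan mu ->
     [\/ exists l : J_label, alg_iso mu (table_alg (J_table l)),
         exists l : M_label R[i], alg_iso mu (table_alg (M_table l)),
         exists l : A_label R[i], alg_iso mu (table_alg (A_table l)) |
         exists l : DJ_label R[i], alg_iso mu (table_alg (DJ_table l))]) /\
  (forall l l' : DJ_label R[i],
     alg_iso (table_alg (DJ_table l)) (table_alg (DJ_table l')) <->
     (l = l' \/ exists a : R[i], l = DJ01 a /\ l' = DJ01 (- a))).
Proof.
split=> [V mu dimV N D|]; first exact: derived_jordan_in_list dimV N D.
exact: DJ_iso.
Qed.
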